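(* Let $\theta>0$, and let the parameters $(z,z',\xi)$ vary within the principal or complementary series in such a way that $$\xi\to0,\quad z\to\infty,\quad z'\to\infty,\quad \xi zz'\to\theta.$$ Then the spectral projection operators $\mathrm{Proj}_+(D_{z,z',\xi})$ strongly converge (i.e. converge in the strong operator topology on $\ell^2(\mathbb{Z}')$) to the spectral projection operator $\mathrm{Proj}_+(D^{\mathrm{Bessel}}_\theta)$.
   Context: $\mathbb{Z}'=\mathbb{Z}+\tfrac12$ is the lattice of half-integers. $\ell^2_0(\mathbb{Z}')\subset\ell^2(\mathbb{Z}')$ is the dense subspace of finitely supported functions. $(z,z',\xi)$ belongs to the principal series if $z,z'\in\mathbb{C}$ are complex conjugate and nonreal and $0<\xi<1$; it belongs to the complementary series if $z,z'$ are real and both lie in one and the same open interval $(m,m+1)$ with $m\in\mathbb{Z}$, and $0<\xi<1$. In both cases $(z+k)(z'+k)>0$ for all $k\in\mathbb{Z}$. The difference operators $\mathcal{D}_{z,z',\xi}$ and $\mathcal{D}^{\mathrm{Bessel}}_\theta$ act on functions $f$ on $\mathbb{Z}'$ by $$\mathcal{D}_{z,z',\xi}f(x)=\sqrt{\xi(z+x+\tfrac12)(z'+x+\tfrac12)}\,f(x+1)-(x+\xi(z+z'+x))f(x)+\sqrt{\xi(z+x-\tfrac12)(z'+x-\tfrac12)}\,f(x-1)$$ (positive square roots) and $$\mathcal{D}^{\mathrm{Bessel}}_\theta f(x)=\sqrt\theta\, f(x+1)-xf(x)+\sqrt\theta\, f(x-1).$$ Considered as symmetric operators in $\ell^2(\mathbb{Z}')$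 with domain $\ell^2_0(\mathbb{Z}')$, both are essentially selfadjoint; $D_{z,z',\xi}$ and $D^{\mathrm{Bessel}}_\theta$ denote their closures. Zero is not an eigenvalue of either operator. For a selfadjoint operator $A$ for which $0$ is not a point of the discrete spectrum (not an eigenvalue), $\mathrm{Proj}_+(A)$ denotes the spectral projection of $A$ corresponding to the positive part $(0,+\infty)$ of its spectrum. *)

(* Defs.v *)
From HB Require Import structures.
From mathcomp Require Import all_boot all_order all_algebra.
From mathcomp Require Import complex.
From mathcomp Require Import all_classical all_reals all_analysis.

Set Implicit Arguments.
Unset Strict Implicit.
Unset Printing Implicit Defensive.

Import Order.TTheory GRing.Theory Num.Theory.
Import numFieldNormedType.Exports.

Local Open Scope classical_set_scope.
Local Open Scope ring_scope.

(* The half-integer n + 1/2 is represented by n : int; a function on Z + 1/2 is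
   a function on int, and x + 1, x - 1 become n + 1, n - 1. *)
Definition half (R : realType) (n : int) : R := n%:~R + 2^-1.

Section HilbertSpace.
Context {R : realType}.
Implicit Types f g h : int -> R[i].

Definition l2 f : Prop :=
  summable [set: int] (fun k => (ComplexField.Normc.normc (f k) ^+ 2)%:E).

Definition l2norm f : R :=
  Num.sqrt (fine
    (\esum_(k in [set: int]) (ComplexField.Normc.normc (f k) ^+ 2)%:E)).

(* A two-sided series, used only when it converges absolutely. Recall that
   Negz i is - (i + 1). *)
Definition zsum (a : int -> R) : R :=
  limn (series (fun i : nat => a (Posz i) + a (Negz i))).

Definition l2dot f g : R[i] :=
  Complex (zsum (fun k => complex.Re (f k * conjc (g k))))
          (zsum (fun k => complex.Im (f k * conjc (g k)))).

Definition l20 f : Prop := finite_set [set k | f k != 0].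

End HilbertSpace.

Section Operators.
Context {R : realType}.

(* An unbounded operator in l2 is represented by its graph; a bounded one by a
   function whose values outside of l2 are irrelevant. *)
Definition graph : Type := set ((int -> R[i]) * (int -> R[i])).

(* The graph of the closure of the operator D with domain l20. *)
Definition op_closure (D : (int -> R[i]) -> (int -> R[i])) : graph :=
  [set p | [/\ l2 p.1, l2 p.2 & forall e : R, 0 < e -> exists h,
     [/\ l20 h, l2norm (p.1 \- h) < e & l2norm (p.2 \- D h) < e]]].

Definition orthogonal_projection (P : (int -> R[i]) -> (int -> R[i])) : Prop :=
  [/\ forall f, l2 f -> l2 (P f),
      forall (c : R[i]) f g, l2 f -> l2 g ->
        P (fun k => c * f k + g k) = (fun k => c * P f k + P g k),
      forall f, l2 f -> P (P f) = P f
    & forall f g, l2 f -> l2 g -> l2dot (P f) g = l2dot f (P g)].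

Definition scalar_measure (E : set R -> (int -> R[i]) -> (int -> R[i]))
    (f : int -> R[i]) (mu : {measure set R -> \bar R}) : Prop :=
  forall B : set R, measurable B -> mu B = (complex.Re (l2dot (E B f) f))%:E.

(* Projection-valued measures on the Borel sets of R. Countable additivity is
   required of the scalar set functions B |-> (E(B) f, f); for projections
   this is equivalent to strong countable additivity. *)
Definition projection_valued_measure
    (E : set R -> (int -> R[i]) -> (int -> R[i])) : Prop :=
  [/\ forall B : set R, measurable B -> orthogonal_projection (E B),
      forall f, l2 f -> E setT f = f,
      forall (A B : set R) f, measurable A -> measurable B -> l2 f ->
        E (A `&` B) f = E A (E B f)
    & forall f, l2 f -> exists mu, scalar_measure E f mu].

(* E is the spectral measure of the operator A, i.e. A is the integral of
   lambda with respect to dE(lambda): the domain of A consists of the f with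
   lambda^2 integrable against (dE f, f), and (A f, f) is the integral of
   lambda against this measure. *)
Definition spectral_measure (A : graph)
    (E : set R -> (int -> R[i]) -> (int -> R[i])) : Prop :=
  projection_valued_measure E /\
  forall f (mu : {measure set R -> \bar R}), l2 f -> scalar_measure E f mu ->
    ((exists g, A (f, g)) <-> (\int[mu]_x ((x ^+ 2)%:E) < +oo)%E) /\
    (forall g, A (f, g) -> l2dot g f = Complex (\int[mu]_x x) 0).

(* By the spectral theorem such a P exists for every selfadjoint A, and it is
   unique as an operator on l2. *)
Definition Proj_plus (A : graph) (P : (int -> R[i]) -> (int -> R[i])) : Prop :=
  exists2 E, spectral_measure A E & forall f, l2 f -> P f = E [set x | 0 < x] f.

End Operators.

Section DifferenceOperators.
Context {R : realType}.
Local Open Scope complex_scope.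

Definition principal_series (z z' : R[i]) (xi : R) : Prop :=
  [/\ z' = conjc z, complex.Im z != 0 & 0 < xi < 1].

Definition complementary_series (z z' : R[i]) (xi : R) : Prop :=
  [/\ complex.Im z = 0, complex.Im z' = 0,
      exists m : int, m%:~R < complex.Re z < (m + 1)%:~R /\
                      m%:~R < complex.Re z' < (m + 1)%:~R
    & 0 < xi < 1].

(* For parameters in either series the radicands are positive reals, and sqrtC
   is then the positive square root. *)
Definition diff_op (z z' : R[i]) (xi : R) (f : int -> R[i]) : int -> R[i] :=
  fun k => let x := (half R k)%:C in
    sqrtC (xi%:C * (z + x + 2^-1) * (z' + x + 2^-1)) * f (k + 1)
    - (x + xi%:C * (z + z' + x)) * f k
    + sqrtC (xi%:C * (z + x - 2^-1) * (z' + x - 2^-1)) * f (k - 1).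

Definition bessel_op (theta : R) (f : int -> R[i]) : int -> R[i] :=
  fun k => let x := (half R k)%:C in
    (Num.sqrt theta)%:C * f (k + 1) - x * f k
    + (Num.sqrt theta)%:C * f (k - 1).

End DifferenceOperators.

(* Main.v *)
Require Import Defs.
From HB Require Import structures.
From mathcomp Require Import all_boot all_order all_algebra.
From mathcomp Require Import complex finmap.
From mathcomp Require Import all_classical all_reals all_analysis.
From mathcomp Require Import measurable_realfun.
From mathcomp Require Import ring lra zify.

Import Order.TTheory GRing.Theory Num.Theory.
Import numFieldNormedType.Exports.
Import ComplexField.Normc.

Local Open Scope classical_set_scope.
Local Open Scope ring_scope.
Local Open Scope complex_scope.

(** The argument is a contraction argument that never mentions resolvents.

    Let [A_t] and [A] be the closures of the hypergeometric and of the Bessel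
    operator, [E_t] and [E] their spectral measures. On a finitely supported
    [h] the image of [h] under the hypergeometric operator converges to its
    image under the Bessel operator, because the coefficients converge one by
    one ([jacobi_cvg], [offdiag_cvg], [diag_cvg]); and such [h] approximate any
    vector of the domain of [A] together with its image.

    Take a band [I = [c - r, c + r]] with [0 <= r < |c|], and a set [J] on the
    other side of the origin, that is [c x <= 0] on [J]. If [g] is in the range
    of [E(I)], then so is [v = A g - c g], and [|v| <= r |g|] ([band_bound]).
    On the other hand [A_t - c] expands by at least [|c|] on the range of
    [E_t(J)] ([halfline_bound]). Approximating [g] by a finitely supported [h]
    and comparing, [|E_t(J) g|] is eventually at most
    [|c|^-1 |E_t(J) v| + e], where [v] is again in the range of [E(I)] and is
    smaller than [g] by the factor [r]. Iterating [n] times gives the bound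
    [(r / |c|)^n |g| + e] ([contraction_step]), hence [E_t(J) g] tends to 0.

    Bands exhaust the open half-lines, so [E_t(x <= 0) u] tends to 0 for [u] in
    the range of [E(x > 0)], and [E_t(x > 0) w] tends to 0 for [w] in the range
    of [E(x < 0)] ([halfline_cvg]). As 0 is not an eigenvalue of [A], every [f]
    is a sum [u + w], and
    [E_t(x > 0) f - E(x > 0) f = E_t(x > 0) w - E_t(x <= 0) u] tends to 0
    ([spectral_projection_cvg]).

    That 0 is not an eigenvalue ([bessel_kernel]) is seen on a discrete
    Wronskian of a solution [g] of the three-term recurrence: the recurrence is
    invariant under reflecting [g] about the origin and alternating its signs,
    so the Wronskian of [g] with the conjugate of its reflection has constant
    modulus. It tends to 0 for square-summable [g], while at the origin its
    modulus is [|g(0)|^2 + |g(-1)|^2]. *)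

Set Implicit Arguments.
Unset Strict Implicit.

(** * Two-sided series *)

Section TwoSidedSums.
Context {R : realType}.
Implicit Types a b : int -> R.

Definition pairs a (i : nat) : R := a (Posz i) + a (Negz i).

Definition zsummable a : Prop := summable [set: int] (fun k => (a k)%:E).

(** The norm is defined by a sum over the index set, the inner product by a limit
    of partial sums that pair [i] with [- (i + 1)]; this is the bridge between
    the two. *)
Lemma esum_int (u : int -> \bar R) : (forall k, 0 <= u k)%E ->
  (\esum_(k in [set: int]) u k =
   \sum_(i <oo) (u (Posz i) + u (Negz i)))%E.
Proof.
move=> u0; rewrite nneseriesD//.
rewrite (esumID (range Posz)) ?setTI; last by move=> *; exact: u0.
have -> : ~` range Posz = range Negz.
  apply/seteqP; split => [[n|n] /=|_ [n _ <-] /= [m _]//].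
    by case; exists n.
  by exists n.
by rewrite !esum_image ?nneseries_esumT // => x y _ _ [].
Qed.

Lemma zsummable_cvg_norm a : zsummable a ->
  cvgn (series (pairs (fun k => `|a k|))).
Proof.
rewrite /zsummable /summable esum_int; last by move=> k; exact: abse_ge0.
by move=> h; apply: nnseries_is_cvg => // i; rewrite /pairs addr_ge0.
Qed.

Lemma zsummable_cvg a : zsummable a -> cvgn (series (pairs a)).
Proof.
move=> /zsummable_cvg_norm ca; apply: normed_cvg.
apply: series_le_cvg ca => i //; rewrite /pairs ?addr_ge0 ?normr_ge0 //.
exact: ler_normD.
Qed.

Lemma zsum_esum a : (forall k, 0 <= a k) -> zsummable a ->
  (\esum_(k in [set: int]) (a k)%:E = (zsum a)%:E)%E.
Proof.
move=> a0 sa; rewrite esum_int; last by move=> k; rewrite lee_fin.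
rewrite /zsum -EFin_lim; last exact: zsummable_cvg.
congr (limn _); apply/funext => n.
by rewrite /= /series /= -sumEFin.
Qed.

Lemma zsummable_le a b : (forall k, `|a k| <= b k) -> zsummable b -> zsummable a.
Proof.
move=> ab; apply: le_lt_trans; apply: le_esum => k _ /=.
by rewrite lee_fin (le_trans (ab k)) ?ler_norm.
Qed.

Lemma zsummableD a b : zsummable a -> zsummable b -> zsummable (a \+ b).
Proof. by move=> sa sb; exact: (summableD sa sb). Qed.

Lemma zsummableZ c a : zsummable a -> zsummable (fun k => c * a k).
Proof.
move=> sa; rewrite /zsummable /summable esum_int; last by move=> k; exact: abse_ge0.
have := zsummable_cvg_norm sa => /(@is_cvg_seriesZ _ _ `|c|) cv.
rewrite (_ : (\sum_(i <oo) _)%E =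
  limn (EFin \o series (`|c| *: pairs (fun k => `|a k|)))); last first.
  congr (limn _); apply/funext => n /=.
  rewrite /series /= -sumEFin; apply: eq_bigr => i _.
  by rewrite !normrM -EFinD -mulrDr.
by rewrite EFin_lim // ltry.
Qed.

Lemma zsumD a b : zsummable a -> zsummable b ->
  zsum (fun k => a k + b k) = zsum a + zsum b.
Proof.
move=> /zsummable_cvg ca /zsummable_cvg cb.
rewrite /zsum -lim_seriesD //; congr (limn (series _)).
by apply/funext => i; rewrite /pairs /= addrACA.
Qed.

Lemma zsumZ c a : zsummable a -> zsum (fun k => c * a k) = c * zsum a.
Proof.
move=> /zsummable_cvg ca.
rewrite /zsum -[RHS]/(c *: _) -lim_seriesZ //; congr (limn (series _)).
by apply/funext => i; rewrite -mulrDr.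
Qed.

Lemma zsum_ge0 a : (forall k, 0 <= a k) -> 0 <= zsum a.
Proof.
move=> a0; rewrite /zsum.
have [cv|/dvgP ->] := pselect (cvgn (series (fun i : nat => a i + a (Negz i)))); last first.
  by [].
apply: limr_ge => //; apply: nearW => n.
by apply: sumr_ge0 => i _; rewrite addr_ge0.
Qed.

Lemma zsum_ge_term a k : (forall k, 0 <= a k) -> zsummable a -> a k <= zsum a.
Proof.
move=> a0 sa; rewrite -lee_fin -zsum_esum //.
rewrite (esumID [set k]) ?setTI; last by move=> i _; rewrite lee_fin.
rewrite esum_set1 ?lee_fin // leeDl //; apply: esum_ge0 => i _.
by rewrite lee_fin.
Qed.

End TwoSidedSums.

(** * The Hilbert space of square-summable functions *)

Section L2.
Context {R : realType}.
Implicit Types (f g h : int -> R[i]) (c : R[i]) (r : R).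

Definition scl c f : int -> R[i] := fun k => c * f k.

(** Only the underlying real inner product is used. The complex structure
    reappears through multiplication by the imaginary unit: see [Im_l2dot] and
    [hdot_ii]. *)
Definition hterm (x y : R[i]) : R :=
  complex.Re x * complex.Re y + complex.Im x * complex.Im y.

Definition hdot f g : R := zsum (fun k => hterm (f k) (g k)).

Lemma normc_sqE (x : R[i]) : normc x ^+ 2 = hterm x x.
Proof. by case: x => a b; rewrite /hterm /= sqr_sqrtr ?addr_ge0 ?sqr_ge0 // !expr2. Qed.

Lemma normc_ge0 (x : R[i]) : 0 <= normc x.
Proof. by case: x => a b; exact: sqrtr_ge0. Qed.

Lemma hterm_ge0 x : 0 <= hterm x x.
Proof. by rewrite -normc_sqE sqr_ge0. Qed.

Lemma Re_l2dot f g : complex.Re (l2dot f g) = hdot f g.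
Proof.
rewrite /= /hdot; congr zsum; apply/funext => k.
by case: (f k) (g k) => a b [c d] /=; rewrite /hterm /=; ring.
Qed.

Lemma Im_l2dot f g : complex.Im (l2dot f g) = hdot f (scl 'i g).
Proof.
rewrite /= /hdot; congr zsum; apply/funext => k; rewrite /scl.
by case: (f k) (g k) => a b [c d] /=; rewrite /hterm /=; ring.
Qed.

Lemma l2E f : l2 f <-> zsummable (fun k => hterm (f k) (f k)).
Proof.
by rewrite /l2 /zsummable; under eq_fun do rewrite normc_sqE.
Qed.

Lemma l2norm_hdot f : l2 f -> l2norm f = Num.sqrt (hdot f f).
Proof.
move=> /l2E lf; rewrite /l2norm; under eq_fun do rewrite normc_sqE.
by rewrite zsum_esum //= => k; exact: hterm_ge0.
Qed.

Lemma hdot_ge0 f : 0 <= hdot f f.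
Proof. by apply: zsum_ge0 => k; exact: hterm_ge0. Qed.

Lemma l2norm_ge0 f : 0 <= l2norm f.
Proof. exact: sqrtr_ge0. Qed.

Lemma l2norm_sq f : l2 f -> l2norm f ^+ 2 = hdot f f.
Proof. by move=> lf; rewrite l2norm_hdot // sqr_sqrtr // hdot_ge0. Qed.

Lemma l2_hterm f g : l2 f -> l2 g -> zsummable (fun k => hterm (f k) (g k)).
Proof.
move=> /l2E lf /l2E lg; apply: zsummable_le (zsummableD lf lg) => k /=.
case: (f k) (g k) => a b [c d]; rewrite /hterm /= ler_norml.
have := (sqr_ge0 (a - c), sqr_ge0 (b - d), sqr_ge0 (a + c), sqr_ge0 (b + d)).
have := (sqr_ge0 a, sqr_ge0 b, sqr_ge0 c, sqr_ge0 d).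
by move=> [[[? ?] ?] ?] [[[? ?] ?] ?]; apply/andP; split; lra.
Qed.

Lemma l2D f g : l2 f -> l2 g -> l2 (f + g).
Proof.
move=> lf lg; apply/l2E.
have := zsummableZ 2 (zsummableD (iffLR (l2E f) lf) (iffLR (l2E g) lg)).
apply: zsummable_le => k /=; rewrite ger0_norm ?hterm_ge0 // !fctE.
case: (f k) (g k) => a b [c d]; rewrite /hterm /=.
by have := (sqr_ge0 (a - c), sqr_ge0 (b - d)) => -[? ?]; lra.
Qed.

Lemma l2_scl c f : l2 f -> l2 (scl c f).
Proof.
move=> /l2E /(zsummableZ (normc c ^+ 2)) lf; apply/l2E.
apply: zsummable_le lf => k /=; rewrite ger0_norm ?hterm_ge0 // /scl.
by rewrite -!normc_sqE normcM exprMn.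
Qed.

Lemma sclN1 f : scl (-1) f = - f.
Proof. by apply/funext => k; rewrite /scl mulN1r. Qed.

Lemma l2N f : l2 f -> l2 (- f).
Proof. by move=> lf; rewrite -sclN1; exact: l2_scl. Qed.

Lemma l2B f g : l2 f -> l2 g -> l2 (f - g).
Proof. by move=> lf lg; apply: l2D => //; exact: l2N. Qed.

Lemma hdotC f g : hdot f g = hdot g f.
Proof.
rewrite /hdot; congr zsum; apply/funext => k.
by rewrite /hterm mulrC [X in _ + X]mulrC.
Qed.

Lemma hdotDl f g h : l2 f -> l2 g -> l2 h ->
  hdot (f + g) h = hdot f h + hdot g h.
Proof.
move=> lf lg lh; rewrite /hdot -zsumD; [|exact: l2_hterm..].
congr zsum; apply/funext => k; rewrite !fctE.
by case: (f k) (g k) (h k) => a b [c d] [x y]; rewrite /hterm /=; ring.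
Qed.

Lemma hdotDr f g h : l2 f -> l2 g -> l2 h ->
  hdot f (g + h) = hdot f g + hdot f h.
Proof. by move=> lf lg lh; rewrite hdotC hdotDl // !(hdotC f). Qed.

Lemma hdotZl r f g : l2 f -> l2 g -> hdot (scl r%:C f) g = r * hdot f g.
Proof.
move=> lf lg; rewrite /hdot -zsumZ; last exact: l2_hterm.
congr zsum; apply/funext => k; rewrite /scl.
by case: (f k) (g k) => a b [c d]; rewrite /hterm /=; ring.
Qed.

Lemma hdotZr r f g : l2 f -> l2 g -> hdot f (scl r%:C g) = r * hdot f g.
Proof. by move=> lf lg; rewrite hdotC hdotZl // hdotC. Qed.

Lemma hdotNl f g : l2 f -> l2 g -> hdot (- f) g = - hdot f g.
Proof.
move=> lf lg; rewrite -sclN1.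
have -> : (-1 : R[i]) = (-1)%:C by rewrite rmorphN1.
by rewrite hdotZl // mulN1r.
Qed.

Lemma hdotNr f g : l2 f -> l2 g -> hdot f (- g) = - hdot f g.
Proof. by move=> lf lg; rewrite hdotC hdotNl // hdotC. Qed.

Lemma hdotBl f g h : l2 f -> l2 g -> l2 h ->
  hdot (f - g) h = hdot f h - hdot g h.
Proof. by move=> lf lg lh; rewrite hdotDl ?hdotNl //; exact: l2N. Qed.

Lemma hdotBr f g h : l2 f -> l2 g -> l2 h ->
  hdot f (g - h) = hdot f g - hdot f h.
Proof. by move=> lf lg lh; rewrite hdotDr ?hdotNr //; exact: l2N. Qed.

Lemma hdot_ii f g : hdot (scl 'i f) (scl 'i g) = hdot f g.
Proof.
rewrite /hdot; congr zsum; apply/funext => k; rewrite /scl.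
by case: (f k) (g k) => a b [c d]; rewrite /hterm /=; ring.
Qed.

Lemma normc_le_l2norm f k : l2 f -> normc (f k) <= l2norm f.
Proof.
move=> lf; rewrite -(@ler_pXn2r _ 2) ?nnegrE ?normc_ge0 ?l2norm_ge0 //.
rewrite l2norm_sq // normc_sqE.
apply: (@zsum_ge_term _ (fun k => hterm (f k) (f k))).
- by move=> k'; exact: hterm_ge0.
- exact: (iffLR (l2E f) lf).
Qed.

Lemma l2norm_eq0 f : l2 f -> l2norm f = 0 -> f = 0.
Proof.
move=> lf f0; apply/funext => k; apply: eq0_normc; apply/eqP.
by rewrite eq_le normc_ge0 andbT -f0; exact: normc_le_l2norm.
Qed.

Lemma l2_0 : l2 (0 : int -> R[i]).
Proof.
apply/l2E; rewrite (_ : (fun _ => _) = (fun k => 0 * 0)).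
  by rewrite /zsummable /summable esum1 ?ltry // => k _; rewrite mul0r /= normr0.
by apply/funext => k; rewrite /hterm /= !mul0r addr0.
Qed.

Lemma hdot0l f : hdot 0 f = 0.
Proof.
rewrite /hdot /zsum (_ : series _ = cst 0) ?lim_cst //.
apply/funext => n; rewrite /series /= big1 // => i _.
by rewrite /hterm /= !mul0r !addr0.
Qed.

Lemma l2norm_cauchy_schwarz f g : l2 f -> l2 g ->
  hdot f g <= l2norm f * l2norm g.
Proof.
move=> lf lg; have [g0|gN0] := eqVneq (l2norm g) 0.
  by rewrite g0 mulr0 (l2norm_eq0 lg g0) hdotC hdot0l.
have gp : 0 < l2norm g by rewrite lt_neqAle eq_sym gN0 l2norm_ge0.
set a := l2norm g in gN0 gp *; set b := l2norm f.
have lF : l2 (scl a%:C f) by exact: l2_scl.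
have lG : l2 (scl b%:C g) by exact: l2_scl.
have H := hdot_ge0 (scl a%:C f - scl b%:C g).
rewrite (hdotBl lF lG (l2B lF lG)) (hdotBr lF lF lG) (hdotBr lG lF lG) in H.
rewrite (hdotZl a lf lF) (hdotZl a lf lG) (hdotZl b lg lF) (hdotZl b lg lG) in H.
rewrite (hdotZr a lf lf) (hdotZr b lf lg) (hdotZr a lg lf) (hdotZr b lg lg) in H.
rewrite (hdotC g f) -(l2norm_sq lf) -(l2norm_sq lg) -/a -/b in H.
have [f0|fN0] := eqVneq b 0.
  by rewrite f0 mul0r (l2norm_eq0 lf f0) hdot0l.
have bp : 0 < b by rewrite lt_neqAle eq_sym fN0 l2norm_ge0.
by rewrite -(ler_pM2l (mulr_gt0 bp gp)); lra.
Qed.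

Lemma l2norm_le_sq f r : l2 f -> 0 <= r -> hdot f f <= r ^+ 2 -> l2norm f <= r.
Proof.
by move=> lf r0; rewrite -l2norm_sq // ler_pXn2r // nnegrE ?l2norm_ge0.
Qed.

Lemma l2normD f g : l2 f -> l2 g -> l2norm (f + g) <= l2norm f + l2norm g.
Proof.
move=> lf lg; apply: l2norm_le_sq; [exact: l2D|by rewrite addr_ge0 ?l2norm_ge0|].
rewrite hdotDl ?hdotDr //; last exact: l2D.
rewrite (hdotC g f) -!l2norm_sq //.
have := l2norm_cauchy_schwarz lf lg; nra.
Qed.

Lemma l2norm_scl c f : l2 f -> l2norm (scl c f) = normc c * l2norm f.
Proof.
move=> lf; apply/eqP; rewrite -(@eqrXn2 _ 2) ?mulr_ge0 ?l2norm_ge0 ?normc_ge0 //.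
rewrite exprMn !l2norm_sq //; last exact: l2_scl.
rewrite /hdot -zsumZ; last exact: (iffLR (l2E f) lf).
apply/eqP; congr zsum; apply/funext => k.
by rewrite /scl -!normc_sqE normcM exprMn.
Qed.

Lemma normc_real r : normc r%:C = `|r|.
Proof. by rewrite /= expr0n /= addr0 sqrtr_sqr. Qed.

Lemma l2normN f : l2 f -> l2norm (- f) = l2norm f.
Proof. by move=> lf; rewrite -sclN1 l2norm_scl // normcN normc1 mul1r. Qed.

Lemma l2normB f g : l2 f -> l2 g -> l2norm (f - g) <= l2norm f + l2norm g.
Proof. by move=> lf lg; rewrite -(l2normN lg) l2normD //; exact: l2N. Qed.

Lemma l2norm0 : l2norm (0 : int -> R[i]) = 0.
Proof. by rewrite l2norm_hdot ?hdot0l ?sqrtr0 //; exact: l2_0. Qed.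

End L2.

Opaque l2 l2norm hdot.

Ltac l2_tac := repeat match goal with
  | H : ?P |- ?P => exact H
  | |- l2 (scl _ _) => apply: l2_scl
  | |- l2 (- _) => apply: l2N
  | |- l2 (_ - _) => apply: l2B
  | |- l2 (_ + _) => apply: l2D
  end.

(** * Integration against scalar spectral measures *)

Section ScalarMeasures.
Context {R : realType}.
Variable mu : {measure set R -> \bar R}.
Hypothesis mu_fin : (mu setT < +oo)%E.

Lemma measurable_sqr_EFin (D : set R) :
  measurable_fun D (fun x : R => (x ^+ 2)%:E).
Proof. by apply/measurable_EFinP; exact: measurable_funX. Qed.

(** [|x| <= 1 + x^2], and the measure is finite. *)
Lemma integrable_of_sqr : (\int[mu]_x ((x ^+ 2)%:E) < +oo)%E ->
  mu.-integrable setT (fun x : R => x%:E).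
Proof.
move=> h; apply/integrableP; split; first exact/measurable_EFinP.
apply: (@le_lt_trans _ _ (\int[mu]_x (1%:E + (x ^+ 2)%:E))%E).
  apply: ge0_le_integral => //=.
  - by apply/measurable_EFinP; exact: normr_measurable.
  - apply: emeasurable_funD; [exact: measurable_cst|exact: measurable_sqr_EFin].
  - move=> x xT; rewrite -EFinD lee_fin ler_norml.
    have := (sqr_ge0 (x - 1), sqr_ge0 (x + 1)) => -[? ?].
    by apply/andP; split; nra.
rewrite ge0_integralD //=; last 2 first.
- by move=> x _; rewrite lee_fin sqr_ge0.
- exact: measurable_sqr_EFin.
by rewrite integral_cst // mul1e lte_add_pinfty.
Qed.

Lemma integral_concentrated (J : set R) (f : R -> \bar R) :
  measurable J -> mu (~` J) = 0%E -> (forall x, 0 <= f x)%E ->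
  measurable_fun setT f ->
  (\int[mu]_x f x = \int[mu]_(x in J) f x)%E.
Proof.
move=> mJ mu0 f0 mf; rewrite (@ge0_negligible_integral _ _ _ _ _ (~` J)) //.
  by rewrite setTD setCK.
exact: measurableC.
Qed.

(** The affine form of the hypothesis serves for upper bounds ([a = 1]), lower
    bounds ([a = -1]) and sign conditions ([b = 0]) on the spectrum alike. *)
Lemma Rintegral_concentrated_le (J : set R) (a b : R) :
  measurable J -> mu (~` J) = 0%E ->
  mu.-integrable setT (fun x : R => x%:E) ->
  (forall x, J x -> a * x <= b) ->
  a * (\int[mu]_x x) <= b * fine (mu setT).
Proof.
move=> mJ mu0 ix ab.
have e1 : (\int[mu]_x x = \int[mu]_(x in J) x)%R.
  rewrite /Rintegral (@negligible_integral _ _ _ _ _ (~` J)) //.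
    by rewrite setTD setCK.
  exact: measurableC.
have e2 : mu setT = mu J.
  rewrite -(setUv J) measureU //=; first by rewrite mu0 adde0.
    exact: measurableC.
  exact: setICr.
have iJ : mu.-integrable J (fun x : R => x%:E).
  exact: integrableS ix.
rewrite e1 e2 -RintegralZl // -Rintegral_cst //.
apply: le_Rintegral => //.
- by have := integrableZl mJ a iJ; apply: eq_integrable.
- apply/integrableP; split; first exact: measurable_cst.
  by rewrite /= integral_cst // lte_mul_pinfty // -e2.
Qed.

End ScalarMeasures.

(** * Projection-valued measures *)

Section SpectralMeasures.
Context {R : realType}.
Variable E : set R -> (int -> R[i]) -> (int -> R[i]).
Hypothesis pvm : projection_valued_measure E.
Implicit Types (f g : int -> R[i]) (B J : set R).

Lemma pvm_l2 B f : measurable B -> l2 f -> l2 (E B f).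
Proof. by move=> mB; have [/(_ B mB) [h _ _ _] _ _ _] := pvm; exact: h. Qed.

Lemma pvm_lin B c f g : measurable B -> l2 f -> l2 g ->
  E B (scl c f + g) = scl c (E B f) + E B g.
Proof. by move=> mB; have [/(_ B mB) [_ h _ _] _ _ _] := pvm; exact: h. Qed.

Lemma scl1 f : scl 1 f = f.
Proof. by apply/funext => k; rewrite [LHS]mul1r. Qed.

Lemma pvm_add B f g : measurable B -> l2 f -> l2 g -> E B (f + g) = E B f + E B g.
Proof. by move=> mB lf lg; rewrite -{1}(scl1 f) pvm_lin // scl1. Qed.

Lemma pvm_zero B : measurable B -> E B 0 = 0.
Proof.
move=> mB; have := pvm_add mB (@l2_0 R) (@l2_0 R); rewrite addr0.
by move=> /eqP; rewrite addrC -subr_eq subrr => /eqP.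
Qed.

Lemma pvm_scl B c f : measurable B -> l2 f -> E B (scl c f) = scl c (E B f).
Proof.
by move=> mB lf; rewrite -[scl c f]addr0 pvm_lin ?pvm_zero ?addr0 //; exact: l2_0.
Qed.

Lemma pvm_sub B f g : measurable B -> l2 f -> l2 g -> E B (f - g) = E B f - E B g.
Proof.
by move=> mB lf lg; rewrite pvm_add -?sclN1 ?pvm_scl //; exact: l2_scl.
Qed.

Lemma pvm_idem B f : measurable B -> l2 f -> E B (E B f) = E B f.
Proof. by move=> mB; have [/(_ B mB) [_ _ h _] _ _ _] := pvm; exact: h. Qed.

Lemma pvm_adj B f g : measurable B -> l2 f -> l2 g ->
  hdot (E B f) g = hdot f (E B g).
Proof.
move=> mB lf lg; have [/(_ B mB) [_ _ _ h] _ _ _] := pvm.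
by rewrite -!Re_l2dot h.
Qed.

Lemma pvm_setT f : l2 f -> E setT f = f.
Proof. by have [_ h _ _] := pvm; exact: h. Qed.

Lemma pvm_setI A B f : measurable A -> measurable B -> l2 f ->
  E (A `&` B) f = E A (E B f).
Proof. by have [_ _ h _] := pvm; exact: h. Qed.

Lemma pvm_sqr B f : measurable B -> l2 f -> hdot (E B f) f = hdot (E B f) (E B f).
Proof. by move=> mB lf; rewrite [RHS]pvm_adj ?pvm_idem ?(hdotC f) //; exact: pvm_l2. Qed.

Lemma scalar_measureE f mu B : l2 f -> scalar_measure E f mu -> measurable B ->
  mu B = (hdot (E B f) (E B f))%:E.
Proof. by move=> lf hmu mB; rewrite hmu // Re_l2dot pvm_sqr. Qed.

Lemma ex_scalar_measure f : l2 f ->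
  exists mu : {measure set R -> \bar R}, scalar_measure E f mu.
Proof. by have [_ _ _ h] := pvm; exact: h. Qed.

Lemma scalar_measureT f mu : l2 f -> scalar_measure E f mu ->
  mu setT = (hdot f f)%:E.
Proof. by move=> lf hmu; rewrite (scalar_measureE lf hmu) // pvm_setT. Qed.

Lemma hdot_eq0 f : l2 f -> hdot f f = 0 -> f = 0.
Proof.
by move=> lf f0; apply: l2norm_eq0 => //; rewrite l2norm_hdot // f0 sqrtr0.
Qed.

Lemma pvm_set0 f : l2 f -> E set0 f = 0.
Proof.
move=> lf; have [mu hmu] := ex_scalar_measure lf.
apply: hdot_eq0; first exact: pvm_l2.
by have := scalar_measureE lf hmu measurable0; rewrite measure0 => -[].
Qed.

Lemma pvm_disjoint A B f : measurable A -> measurable B -> A `&` B = set0 ->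
  l2 f -> E A (E B f) = 0.
Proof. by move=> mA mB AB lf; rewrite -pvm_setI // AB pvm_set0. Qed.

(** Additivity is known only for the scalar measures. The defect
    [w = f - E(B) f - E(~B) f] is killed by both projections, so
    [(w, w) = (w, f)], and this number is the defect of additivity of the scalar
    measure of [f]. *)
Lemma pvm_split B f : measurable B -> l2 f -> f = E B f + E (~` B) f.
Proof.
move=> mB lf; have mC := measurableC mB.
have lB := pvm_l2 mB lf; have lC := pvm_l2 mC lf.
have [mu hmu] := ex_scalar_measure lf.
apply/eqP; rewrite -subr_eq0 opprD addrA; apply/eqP.
apply: hdot_eq0; first by l2_tac.
set w := _ - _ - _; have lw : l2 w by rewrite /w; l2_tac.
have wB : E B w = 0.
  rewrite /w !pvm_sub ?pvm_idem ?subrr ?pvm_disjoint ?subr0 ?setICr //; by l2_tac.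
have wC : E (~` B) w = 0.
  rewrite /w !pvm_sub ?pvm_idem ?pvm_disjoint ?subr0 ?subrr ?setICl //; by l2_tac.
have h1 : hdot w (E B f) = 0 by rewrite -pvm_adj // wB hdot0l.
have h2 : hdot w (E (~` B) f) = 0 by rewrite -pvm_adj // wC hdot0l.
rewrite {2}/w (hdotBr lw (l2B lf lB) lC) (hdotBr lw lf lB) h1 h2 !subr0.
rewrite /w (hdotBl (l2B lf lB) lC lf) (hdotBl lf lB lf) !pvm_sqr //.
have : mu setT = (mu B + mu (~` B))%E.
  by rewrite -(setUv B) measureU // setICr.
rewrite (scalar_measureT lf hmu) !(scalar_measureE lf hmu) // => -[->].
by rewrite addrAC addrK subrr.
Qed.

Lemma pvm_setC B f : measurable B -> l2 f -> E (~` B) f = f - E B f.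
Proof.
by move=> mB lf; rewrite {2}(pvm_split mB lf) addrC addKr.
Qed.

Lemma pvm_norm_le B f : measurable B -> l2 f -> l2norm (E B f) <= l2norm f.
Proof.
move=> mB lf; have lE := pvm_l2 mB lf.
have := l2norm_cauchy_schwarz lE lf; rewrite pvm_sqr // -l2norm_sq // expr2.
have [->|h] := eqVneq (l2norm (E B f)) 0; first by rewrite l2norm_ge0.
by rewrite ler_pM2l // lt_neqAle eq_sym h l2norm_ge0.
Qed.

Lemma scalar_measure_concentrated J f mu : measurable J -> l2 f ->
  scalar_measure E f mu -> E J f = f -> mu (~` J) = 0%E.
Proof.
move=> mJ lf hmu Ef; rewrite (scalar_measureE lf hmu) ?pvm_setC //.
  by rewrite Ef subrr hdot0l.
exact: measurableC.
Qed.

(** Continuity from below of the scalar measure of [f]. *)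
Lemma pvm_cvg (J_ : nat -> set R) f :
  (forall n, measurable (J_ n)) -> nondecreasing_seq J_ ->
  l2 f -> l2norm (E (J_ n) f) @[n --> \oo] --> l2norm (E (\bigcup_n J_ n) f).
Proof.
move=> mJ nd lf; have [mu hmu] := ex_scalar_measure lf.
have mU : measurable (\bigcup_n J_ n) by exact: bigcupT_measurable.
have h := @nondecreasing_cvg_mu _ _ _ mu _ mJ mU nd.
rewrite (scalar_measureE lf hmu) // in h.
under eq_fun do rewrite (l2norm_hdot (pvm_l2 (mJ _) lf)).
rewrite (l2norm_hdot (pvm_l2 mU lf)).
apply: continuous_cvg; first exact: sqrt_continuous.
have e : mu \o J_ = (fun n => (hdot (E (J_ n) f) (E (J_ n) f))%:E).
  by apply/funext => n /=; rewrite (scalar_measureE lf hmu).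
by move: h; rewrite e => /fine_cvgP [_].
Qed.

End SpectralMeasures.

(** * Operators with a spectral measure *)

Section SpectralCalculus.
Context {R : realType}.
Variable A : @graph R.
Variable E : set R -> (int -> R[i]) -> (int -> R[i]).
Hypothesis A_l2 : forall f f', A (f, f') -> l2 f /\ l2 f'.
Hypothesis A_lin : forall c f f' g g', A (f, f') -> A (g, g') ->
  A (scl c f + g, scl c f' + g').
Hypothesis hE : spectral_measure A E.
Implicit Types (f g : int -> R[i]) (B J : set R) (r c s : R).

Let pvm : projection_valued_measure E := hE.1.

Lemma graph_add f f' g g' : A (f, f') -> A (g, g') -> A (f + g, f' + g').
Proof. by move=> hf hg; have := A_lin 1 hf hg; rewrite !scl1. Qed.

Lemma graph_sub f f' g g' : A (f, f') -> A (g, g') -> A (f - g, f' - g').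
Proof.
move=> hf hg; have := A_lin (-1) hg hf.
by rewrite !sclN1 ![- _ + _]addrC.
Qed.

Lemma domain_sqr_integrable f mu : l2 f -> scalar_measure E f mu ->
  (exists g, A (f, g)) <-> (\int[mu]_x ((x ^+ 2)%:E) < +oo)%E.
Proof. by move=> lf hmu; have [] := hE.2 f mu lf hmu. Qed.

Lemma quad_form f f' mu : scalar_measure E f mu -> A (f, f') ->
  hdot f' f = \int[mu]_x x.
Proof.
move=> hmu hA; have [_ h] := hE.2 f mu (A_l2 hA).1 hmu.
by rewrite -Re_l2dot (h _ hA).
Qed.

Lemma quad_form_real f f' : A (f, f') -> hdot f' (scl 'i f) = 0.
Proof.
move=> hA; have lf := (A_l2 hA).1.
have [mu hmu] := ex_scalar_measure pvm lf.
have [_ h] := hE.2 f mu lf hmu.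
by rewrite -Im_l2dot (h _ hA).
Qed.

Lemma domain_integrable f f' mu : scalar_measure E f mu -> A (f, f') ->
  mu.-integrable setT (fun x : R => x%:E).
Proof.
move=> hmu hA; have lf := (A_l2 hA).1.
apply: integrable_of_sqr; first by rewrite (scalar_measureT pvm lf hmu) ltry.
by apply/(domain_sqr_integrable lf hmu); exists f'.
Qed.

(** Polarization: [(A h, h)] is real for [h = i g + f], and the imaginary part of
    its cross terms is the difference of the two sides. *)
Lemma graph_symmetric f f' g g' : A (f, f') -> A (g, g') -> hdot f' g = hdot f g'.
Proof.
move=> hf hg; have [lf lf'] := A_l2 hf; have [lg lg'] := A_l2 hg.
have := quad_form_real (A_lin 'i hg hf).
have -> : scl 'i (scl 'i g + f) = scl 'i f - g.
  apply/funext => k; rewrite !fctE /scl mulrDr mulrA -expr2 sqr_i mulN1r.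
  by rewrite addrC.
have lig : l2 (scl 'i g') by l2_tac.
have lif : l2 (scl 'i f) by l2_tac.
rewrite (hdotDl lig lf' (l2B lif lg)) (hdotBr lig lif lg) (hdotBr lf' lif lg).
rewrite hdot_ii (quad_form_real hf) sub0r (hdotC _ g).
have -> : hdot g (scl 'i g') = - hdot g' (scl 'i g).
  rewrite -(hdot_ii g) hdotC.
  have -> : scl 'i (scl 'i g') = - g'.
    by apply/funext => k; rewrite !fctE /scl mulrA -expr2 sqr_i mulN1r.
  by rewrite hdotNl //; l2_tac.
rewrite (quad_form_real hg) oppr0 subr0 (hdotC g') => /eqP.
by rewrite subr_eq0 => /eqP ->.
Qed.

Lemma quad_form_le J f f' a b : measurable J -> A (f, f') -> E J f = f ->
  (forall x, J x -> a * x <= b) -> a * hdot f' f <= b * hdot f f.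
Proof.
move=> mJ hA Ef ab; have lf := (A_l2 hA).1.
have [mu hmu] := ex_scalar_measure pvm lf.
have fT := scalar_measureT pvm lf hmu.
have := @Rintegral_concentrated_le _ mu _ J a b mJ _ _ ab.
rewrite fT ltry /= (quad_form hmu hA); apply => //.
  exact: (scalar_measure_concentrated pvm mJ lf hmu).
exact: domain_integrable hmu hA.
Qed.

(** The cross terms [(E(B) f, g)] vanish, so the scalar measure of [f + g] is the
    sum of those of [f] and [g], and the quadratic form is additive on the pair;
    thus [(A f, g) + (A g, f) = 0], and symmetry makes both terms equal. *)
Lemma graph_orthogonal J f f' g g' : measurable J -> A (f, f') -> A (g, g') ->
  E J f = 0 -> E J g = g -> hdot f' g = 0.
Proof.
move=> mJ hf hg Ef Eg; have [lf lf'] := A_l2 hf; have [lg lg'] := A_l2 hg.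
have [mf hmf] := ex_scalar_measure pvm lf.
have [mg hmg] := ex_scalar_measure pvm lg.
have lfg := l2D lf lg.
have [m hm] := ex_scalar_measure pvm lfg.
have cross B : measurable B -> hdot (E B f) g = 0.
  move=> mB; have lB := pvm_l2 pvm mB lf.
  rewrite -Eg -(pvm_adj pvm mJ lB lg) -(pvm_setI pvm) // setIC (pvm_setI pvm) // Ef.
  by rewrite (pvm_zero pvm) // hdot0l.
have mE B : measurable B -> m B = measure_add mf mg B.
  move=> mB; rewrite /= measure_addE hm // hmf // hmg // !Re_l2dot -EFinD.
  have lB := pvm_l2 pvm mB lf; have lB' := pvm_l2 pvm mB lg.
  rewrite (pvm_add pvm) // hdotDl // ?hdotDr // cross // addr0.
  rewrite (pvm_adj pvm mB lg lf) (hdotC g) cross // add0r //.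
have := quad_form hm (graph_add hf hg).
rewrite /Rintegral (eq_measure_integral (measure_add mf mg)); last first.
  by move=> B mB _; exact: mE.
rewrite integral_measure_add //; last 2 first.
- exact: domain_integrable hmf hf.
- exact: domain_integrable hmg hg.
rewrite fineD; last 2 first.
- by apply: integrable_fin_num => //; exact: domain_integrable hmf hf.
- by apply: integrable_fin_num => //; exact: domain_integrable hmg hg.
rewrite -[fine (integral mf _ _)]/(\int[mf]_x x).
rewrite -[fine (integral mg _ _)]/(\int[mg]_x x).
rewrite -(quad_form hmf hf) -(quad_form hmg hg).
rewrite (hdotDl lf' lg' lfg) (hdotDr lf' lf lg) (hdotDr lg' lf lg).
rewrite (hdotC g' f) -(graph_symmetric hf hg); lra.
Qed.

(** The scalar measure of [E(J) f] is the restriction to [J] of that of [f]. *)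
Lemma domain_stable J f f' : measurable J -> A (f, f') -> exists u', A (E J f, u').
Proof.
move=> mJ hA; have lf := (A_l2 hA).1; have lE := pvm_l2 pvm mJ lf.
have [mu hmu] := ex_scalar_measure pvm lf.
have [nu hnu] := ex_scalar_measure pvm lE.
have m2 := @measurable_sqr_EFin R.
have p2 (x : R) : (0 <= (x ^+ 2)%:E)%E by rewrite lee_fin sqr_ge0.
apply/(domain_sqr_integrable lE hnu); rewrite (@integral_concentrated _ nu J) //; last first.
  by apply: (scalar_measure_concentrated pvm mJ lE hnu); exact: pvm_idem.
rewrite (eq_measure_integral mu); last first.
  move=> B mB BJ; rewrite (scalar_measureE pvm lf hmu) //.
  by rewrite (scalar_measureE pvm lE hnu) // -(pvm_setI pvm) // (setIidl BJ).
apply: le_lt_trans ((iffLR (domain_sqr_integrable lf hmu)) (ex_intro _ _ hA)).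
exact: ge0_subset_integral.
Qed.

Lemma domain_bounded J f M : measurable J -> l2 f -> E J f = f ->
  (forall x, J x -> `|x| <= M) -> exists f', A (f, f').
Proof.
move=> mJ lf Ef JM; have [mu hmu] := ex_scalar_measure pvm lf.
have m2 := @measurable_sqr_EFin R.
have p2 (x : R) : (0 <= (x ^+ 2)%:E)%E by rewrite lee_fin sqr_ge0.
apply/(domain_sqr_integrable lf hmu); rewrite (@integral_concentrated _ mu J) //; last first.
  exact: (scalar_measure_concentrated pvm mJ lf hmu).
apply: (@le_lt_trans _ _ (\int[mu]_(x in J) (M ^+ 2)%:E)%E).
  apply: ge0_le_integral => // x Jx.
  rewrite lee_fin -(real_normK (num_real x)) lerXn2r ?nnegrE ?JM //.
  exact: le_trans (normr_ge0 x) (JM x Jx).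
rewrite integral_cst // lte_mul_pinfty ?lee_fin ?sqr_ge0 //.
by rewrite (scalar_measureE pvm lf hmu) // ltry.
Qed.

(** The vectors [E(J_n) f'] with [J_n] the bounded part of [J] lie in the domain,
    so [graph_orthogonal] applies to them: [f'] is orthogonal to [E(J_n) f'],
    hence [E(J_n) f' = 0]; now let [n] tend to infinity. *)
Lemma graph_reducing J f f' : measurable J -> A (f, f') -> E J f = 0 -> E J f' = 0.
Proof.
move=> mJ hA Ef; have [lf lf'] := A_l2 hA.
pose K n : set R := [set x | `|x| <= n%:R].
have mK n : measurable (K n).
  rewrite (_ : K n = `[- n%:R, n%:R]%classic); first exact: measurable_itv.
  by apply/seteqP; split => x; rewrite /K /= in_itv /= ler_norml.
pose J_ n := J `&` K n.
have mJ_ n : measurable (J_ n) by exact: measurableI.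
have JU : \bigcup_n J_ n = J.
  apply/seteqP; split => [x [n _ []] //|x Jx].
  exists (Num.truncn `|x|).+1 => //; split => //; rewrite /K /=.
  exact/ltW/truncnS_gt.
have nd : nondecreasing_seq J_.
  move=> m n mn; apply/subsetPset => x [Jx Kx]; split => //.
  by apply: le_trans Kx _; rewrite ler_nat.
have J_0 n : l2norm (E (J_ n) f') = 0.
  set w := E (J_ n) f'; have lw : l2 w by exact: pvm_l2.
  have Ew : E (J_ n) w = w by exact: pvm_idem.
  have JK x : J_ n x -> `|x| <= n%:R by case.
  have [w' hw] := domain_bounded (mJ_ n) lw Ew JK.
  have : hdot f' w = 0.
    apply: (graph_orthogonal (mJ_ n) hA hw) => //.
    by rewrite /J_ setIC (pvm_setI pvm) // Ef (pvm_zero pvm).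
  by rewrite l2norm_hdot // /w hdotC (pvm_sqr pvm) // => ->; rewrite sqrtr0.
have := pvm_cvg pvm mJ_ nd lf'; rewrite JU.
under eq_fun do rewrite J_0.
move=> h; apply: l2norm_eq0; first exact: pvm_l2.
by apply/esym; apply: (cvg_unique _ (cvg_cst 0) h).
Qed.

(** With [u = E(J) f] and [u'] its image, [graph_reducing] applies to [f - u] on [J]
    and to [u] on the complement of [J]: [u'] is in the range of [E(J)] and has
    the same projection as [f']. *)
Lemma graph_commute J f f' : measurable J -> A (f, f') -> A (E J f, E J f').
Proof.
move=> mJ hA; have [lf lf'] := A_l2 hA; have mC := measurableC mJ.
have [u' hu] := domain_stable mJ hA; have [lu lu'] := A_l2 hu.
have h1 : E J (f' - u') = 0.
  by apply: (graph_reducing mJ (graph_sub hA hu)); rewrite (pvm_sub pvm) // pvm_idem // subrr.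
have h2 : E (~` J) u' = 0.
  by apply: (graph_reducing mC hu); rewrite (pvm_disjoint pvm) // setICl.
have -> : E J f' = u'; last by [].
rewrite [RHS](pvm_split pvm mJ lu') h2 addr0; apply/eqP.
by rewrite -subr_eq0 -(pvm_sub pvm) // h1.
Qed.

(** The symmetric form [((A - c) h, h)] is bounded by [r (h, h)] on the range of
    [E(J)]. For a symmetric form this bounds the operator norm: apply it to
    [h = g + s v] and [h = g - s v] with [v = (A - c) g], subtract, and use the
    parallelogram law; this gives [2 s |v|^2 <= r (|g|^2 + s^2 |v|^2)], and
    [s = 1 / r] is the optimal choice; for [r = 0] any positive [s] will do. *)
Lemma band_bound J g c r : measurable J -> l2 g -> E J g = g -> 0 <= r ->
  (forall x, J x -> `|x - c| <= r) ->
  exists2 g', A (g, g') &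
    E J g' = g' /\ l2norm (g' - scl c%:C g) <= r * l2norm g.
Proof.
move=> mJ lg Eg r0 Jr.
have JM x : J x -> `|x| <= r + `|c|.
  move=> Jx; rewrite -[x in `|x|](subrK c) (le_trans (ler_normD _ _)) //.
  by rewrite lerD2r Jr.
have [g' hg] := domain_bounded mJ lg Eg JM; exists g' => //.
have [_ lg'] := A_l2 hg.
have Eg' : E J g' = g'.
  have mC := measurableC mJ.
  have h : E (~` J) g' = 0.
    by apply: (graph_reducing mC hg); rewrite -Eg (pvm_disjoint pvm) // setICl.
  by rewrite [RHS](pvm_split pvm mJ lg') h addr0.
split => //; set v := g' - scl c%:C g.
have lcg : l2 (scl c%:C g) by l2_tac.
have lv : l2 v by exact: l2B.
have Ev : E J v = v by rewrite /v (pvm_sub pvm) // (pvm_scl pvm) // Eg' Eg.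
have [v' hv] := domain_bounded mJ lv Ev JM; have [_ lv'] := A_l2 hv.
(* [n s] and [q s] are [(h, h)] and [((A - c) h, h)] for [h = g + s v]. *)
pose q s := hdot g' g + 2 * s * hdot g' v + s ^+ 2 * hdot v' v
   - c * (hdot g g + 2 * s * hdot g v + s ^+ 2 * hdot v v).
pose n s := hdot g g + 2 * s * hdot g v + s ^+ 2 * hdot v v.
have qn s : - (r * n s) <= q s <= r * n s.
  have hs := A_lin s%:C hv hg; have [ls ls'] := A_l2 hs.
  have Es : E J (scl s%:C v + g) = scl s%:C v + g by rewrite (pvm_lin pvm) // Ev Eg.
  have lsv : l2 (scl s%:C v) by l2_tac.
  have lsv' : l2 (scl s%:C v') by l2_tac.
  have e1 : hdot (scl s%:C v + g) (scl s%:C v + g) = n s.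
    rewrite (hdotDl lsv lg ls) (hdotDr lsv lsv lg) (hdotDr lg lsv lg).
    rewrite (hdotZl s lv lsv) (hdotZl s lv lg) (hdotZr s lv lv) (hdotZr s lg lv).
    by rewrite (hdotC v g) /n; ring.
  have e2 : hdot (scl s%:C v' + g') (scl s%:C v + g)
    = hdot g' g + 2 * s * hdot g' v + s ^+ 2 * hdot v' v.
    rewrite (hdotDl lsv' lg' ls) (hdotDr lsv' lsv lg) (hdotDr lg' lsv lg).
    rewrite (hdotZl s lv' lsv) (hdotZl s lv' lg) (hdotZr s lv' lv).
    by rewrite (hdotZr s lg' lv) (graph_symmetric hv hg) (hdotC v g'); ring.
  have := @quad_form_le J _ _ 1 (c + r) mJ hs Es.
  have := @quad_form_le J _ _ (-1) (r - c) mJ hs Es.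
  rewrite e1 e2 => h1 h2; rewrite /q -/(n s).
  have {}h1 := h1 _; have {}h2 := h2 _.
  apply/andP; split.
    suff: -1 * (hdot g' g + 2 * s * hdot g' v + s ^+ 2 * hdot v' v) <= (r - c) * n s by lra.
    by apply: h1 => x /Jr; rewrite ler_norml => /andP[]; lra.
  suff: 1 * (hdot g' g + 2 * s * hdot g' v + s ^+ 2 * hdot v' v) <= (c + r) * n s by lra.
  by apply: h2 => x /Jr; rewrite ler_norml => /andP[]; lra.
have vv : hdot g' v = hdot v v + c * hdot g v.
  by rewrite {2}/v (hdotBl lg' lcg lv) (hdotZl c lg lv) subrK.
have key s : 2 * s * hdot v v <= r * (hdot g g + s ^+ 2 * hdot v v).
  have /andP[_ h1] := qn s; have /andP[h2 _] := qn (- s).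
  by move: h1 h2; rewrite /q /n vv; lra.
apply: l2norm_le_sq => //; first by rewrite mulr_ge0 // l2norm_ge0.
rewrite exprMn l2norm_sq //.
have [r00|rN0] := eqVneq r 0.
  by have := key 1; rewrite r00; lra.
have rp : 0 < r by rewrite lt_neqAle eq_sym rN0.
have := key r^-1; rewrite -(ler_pM2l (exprn_gt0 3 rp)).
have -> : r ^+ 3 * (2 * r^-1 * hdot v v) = r * (2 * r * hdot v v) by field.
have -> : r ^+ 3 * (r * (hdot g g + r^-1 ^+ 2 * hdot v v)) =
  r * (r ^+ 3 * hdot g g + r * hdot v v) by field.
rewrite ler_pM2l // => h.
rewrite -(ler_pM2l rp); lra.
Qed.

(** For [u = E(J) h] the number [c (A u, u)] is nonpositive, so
    [((A - c) u, - c u) >= c^2 (u, u)]; conclude by Cauchy-Schwarz. *)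
Lemma halfline_bound J h h' c : measurable J -> A (h, h') ->
  (forall x, J x -> c * x <= 0) ->
  `|c| * l2norm (E J h) <= l2norm (E J (h' - scl c%:C h)).
Proof.
move=> mJ hA Jc; have [lh lh'] := A_l2 hA.
have lch : l2 (scl c%:C h) by l2_tac.
rewrite (pvm_sub pvm) // (pvm_scl pvm) //.
have hu := graph_commute mJ hA; have [lu lu'] := A_l2 hu.
set u := E J h in hu lu *; set u' := E J h' in hu lu' *.
have Eu : E J u = u by exact: pvm_idem.
have := quad_form_le mJ hu Eu Jc; rewrite mul0r => q0.
have lcu : l2 (scl c%:C u) by l2_tac.
have ld : l2 (u' - scl c%:C u) by exact: l2B.
have := l2norm_cauchy_schwarz ld (l2N lcu).
rewrite l2normN // l2norm_scl // normc_real (hdotNr ld lcu) (hdotZr c ld lu).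
rewrite (hdotBl lu' lcu lu) (hdotZl c lu lu) => cs.
have {}cs : (`|c| * l2norm u) ^+ 2 <=
    l2norm (u' - scl c%:C u) * (`|c| * l2norm u).
  rewrite exprMn l2norm_sq // real_normK ?num_real //; nra.
have [->|n0] := eqVneq (`|c| * l2norm u) 0; first exact: l2norm_ge0.
rewrite expr2 ler_pM2r // in cs.
by rewrite lt_neqAle eq_sym n0 mulr_ge0 // l2norm_ge0.
Qed.

End SpectralCalculus.

(** * Closures of difference operators *)

Section OperatorClosure.
Context {R : realType}.
Implicit Types (f g h : int -> R[i]) (c : R[i]).

Lemma l2_finite_support (S : set int) f : finite_set S ->
  (forall k, ~ S k -> f k = 0) ->
  l2 f /\ hdot f f = \sum_(k <- fset_set S) hterm (f k) (f k).
Proof.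
move=> fS f0.
have h0 k : (0 <= (hterm (f k) (f k))%:E)%E by rewrite lee_fin hterm_ge0.
have e : (\esum_(k in [set: int]) (hterm (f k) (f k))%:E =
    (\sum_(k <- fset_set S) hterm (f k) (f k))%:E)%E.
  rewrite (esumID S) ?setTI; last by move=> k _; exact: h0.
  rewrite [X in (_ + X)%E]esum1 => [|k /f0 ->]; last by rewrite /hterm /= !mul0r addr0.
  by rewrite adde0 esum_fset // fsbig_finite //= sumEFin.
have sm : zsummable (fun k => hterm (f k) (f k)).
  rewrite /zsummable /summable.
  under eq_esum => k _ do rewrite (gee0_abs (h0 k)).
  by rewrite e ltry.
split; first by apply/(l2E f).
apply: EFin_inj; rewrite -e zsum_esum //.
Qed.

Lemma l20_l2 f : l20 f -> l2 f.
Proof.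
move=> f0; apply: (l2_finite_support f0 _).1 => k /=.
by move/negP; rewrite negbK => /eqP.
Qed.

Lemma l20_lin c f g : l20 f -> l20 g -> l20 (scl c f + g).
Proof.
move=> lf lg; apply: (@sub_finite_set _ _ ([set k | f k != 0] `|` [set k | g k != 0])).
  move=> k /=; rewrite fctE /scl => h.
  have [f0|] := eqVneq (f k) 0; last by left.
  by right; apply: contraNneq h => ->; rewrite f0 mulr0 addr0.
by rewrite finite_setU.
Qed.

Section Closure.
Variable D : (int -> R[i]) -> (int -> R[i]).
Hypothesis D_lin : forall c f g, D (scl c f + g) = scl c (D f) + D g.
Hypothesis D_l2 : forall h, l20 h -> l2 (D h).

Lemma op_closure_l2 f f' : op_closure D (f, f') -> l2 f /\ l2 f'.
Proof. by case. Qed.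

Lemma op_closure_l20 h : l20 h -> op_closure D (h, D h).
Proof.
move=> lh; split => /=; [exact: l20_l2|exact: D_l2|].
move=> e e0; exists h; split => //.
  by rewrite [X in l2norm X](_ : _ = 0) ?l2norm0 // -[LHS]/(h - h) subrr.
by rewrite [X in l2norm X](_ : _ = 0) ?l2norm0 // -[LHS]/(D h - D h) subrr.
Qed.

Lemma op_closure_approx f f' e : op_closure D (f, f') -> 0 < e ->
  exists h, [/\ l20 h, l2norm (f - h) < e & l2norm (f' - D h) < e].
Proof. by move=> [_ _ h] e0; exact: h. Qed.

Lemma op_closure_lin c f f' g g' : op_closure D (f, f') ->
  op_closure D (g, g') -> op_closure D (scl c f + g, scl c f' + g').
Proof.
move=> hf hg; have [lf lf'] := op_closure_l2 hf.
have [lg lg'] := op_closure_l2 hg.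
split => /=; [by l2_tac|by l2_tac|] => e e0.
have c1 : 0 < normc c + 1 by rewrite ltr_wpDl ?normc_ge0.
have d0 : 0 < e / (normc c + 1) by rewrite divr_gt0.
have [h1 [lh1 a1 b1]] := op_closure_approx hf d0.
have [h2 [lh2 a2 b2]] := op_closure_approx hg d0.
have lin u v a b : l2 (a : int -> R[i]) -> l2 b -> l2 u -> l2 v ->
    l2norm (a - u) < e / (normc c + 1) -> l2norm (b - v) < e / (normc c + 1) ->
    l2norm (scl c a + b - (scl c u + v)) < e.
  move=> la lb lu lv hu hv.
  have -> : scl c a + b - (scl c u + v) = scl c (a - u) + (b - v).
    by apply/funext => k; rewrite !fctE /scl; ring.
  apply: le_lt_trans (l2normD _ _) _; [by l2_tac..|].
  rewrite l2norm_scl; last by l2_tac.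
  apply: (@le_lt_trans _ _ (normc c * (e / (normc c + 1)) + l2norm (b - v))).
    by rewrite lerD2r ler_wpM2l ?normc_ge0 // ltW.
  apply: (@lt_le_trans _ _ ((normc c + 1) * (e / (normc c + 1)))).
    by rewrite mulrDl mul1r ltrD2l.
  by rewrite mulrC divfK // gt_eqF.
exists (scl c h1 + h2); split; first exact: l20_lin.
  by apply: lin => //; exact: l20_l2.
rewrite D_lin; apply: lin => //; exact: D_l2.
Qed.

End Closure.

(** A common form for the hypergeometric and the Bessel operators. *)
Definition jacobi (a b d : int -> R[i]) f : int -> R[i] :=
  fun k => a k * f (k + 1) - b k * f k + d k * f (k - 1).

Lemma jacobi_lin a b d c f g :
  jacobi a b d (scl c f + g) = scl c (jacobi a b d f) + jacobi a b d g.
Proof. by apply/funext => k; rewrite !fctE /scl /jacobi; ring. Qed.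

Definition nbhd_support f : set int :=
  [set k | f (k + 1) != 0] `|` [set k | f k != 0] `|` [set k | f (k - 1) != 0].

Lemma finite_nbhd_support f : l20 f -> finite_set (nbhd_support f).
Proof.
move=> lf.
have sh (s : int) : finite_set [set k | f (k + s) != 0].
  apply: (@sub_finite_set _ _ ((fun k => k - s) @` [set k | f k != 0])).
    by move=> k /= h; exists (k + s); rewrite ?addrK.
  exact: finite_image.
by rewrite /nbhd_support !finite_setU.
Qed.

Lemma jacobi_support a b d f k : ~ nbhd_support f k -> jacobi a b d f k = 0.
Proof.
move=> /not_orP [/not_orP [/negP + /negP +] /negP]; rewrite !negbK.
by move=> /eqP h1 /eqP h2 /eqP h3; rewrite /jacobi h1 h2 h3 !mulr0 subr0 addr0.
Qed.

Lemma jacobi_l2 a b d f : l20 f -> l2 (jacobi a b d f).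
Proof.
move=> lf; apply: (l2_finite_support (finite_nbhd_support lf) _).1 => k.
exact: jacobi_support.
Qed.

(** Each value of the image depends on three values of the argument, and norm
    convergence implies pointwise convergence; so the closure still acts by the
    same formula. *)
Lemma op_closure_jacobi a b d f f' :
  op_closure (jacobi a b d) (f, f') -> f' = jacobi a b d f.
Proof.
move=> hf; have [lf lf'] := op_closure_l2 hf.
apply/funext => k; apply/eqP; rewrite -subr_eq0; apply/eqP; apply: eq0_normc.
apply/eqP; rewrite eq_le normc_ge0 andbT; apply/ler_addgt0Pl => e e0.
rewrite addr0.
pose K := 1 + normc (a k) + normc (b k) + normc (d k).
have K0 : 0 < K by rewrite /K -!addrA ltr_pwDl // !addr_ge0 ?normc_ge0.
have [h [lh h1 h2]] := op_closure_approx hf (divr_gt0 e0 K0).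
have lh2 := l20_l2 lh; have lD := jacobi_l2 a b d lh.
have -> : f' k - jacobi a b d f k = (f' - jacobi a b d h) k
   + (- a k * (f - h) (k + 1) + (b k * (f - h) k + - d k * (f - h) (k - 1))).
  by rewrite !fctE /jacobi; ring.
have bd j : normc ((f - h) j) <= e / K.
  exact: le_trans (normc_le_l2norm _ (l2B lf lh2)) (ltW h1).
have bd' : normc ((f' - jacobi a b d h) k) <= e / K.
  exact: le_trans (normc_le_l2norm _ (l2B lf' lD)) (ltW h2).
apply: (@le_trans _ _ (K * (e / K))); last by rewrite mulrC divfK // gt_eqF.
have q0 : 0 <= e / K by rewrite divr_ge0 // ltW.
set q := e / K in q0 bd bd' *.
have -> : K * q = q + (normc (a k) * q + (normc (b k) * q + normc (d k) * q)).
  by rewrite /K; ring.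
apply: le_trans (le_normcD _ _) _; apply: lerD => //.
apply: le_trans (le_normcD _ _) _; apply: lerD.
  by rewrite normcM normcN ler_wpM2l ?normc_ge0.
apply: le_trans (le_normcD _ _) _; rewrite !normcM normcN.
by apply: lerD; rewrite ler_wpM2l ?normc_ge0.
Qed.

(** The difference is supported in a finite set that does not depend on [t], so
    its norm is a finite sum of terms tending to 0. *)
Lemma jacobi_cvg (T : Type) (F : set_system T) (FF : Filter F)
  (a_ b_ d_ : T -> int -> R[i]) (a b d : int -> R[i]) h :
  (forall k, normc (a_ t k - a k) @[t --> F] --> (0 : R)) ->
  (forall k, normc (b_ t k - b k) @[t --> F] --> (0 : R)) ->
  (forall k, normc (d_ t k - d k) @[t --> F] --> (0 : R)) ->
  l20 h ->
  l2norm (jacobi (a_ t) (b_ t) (d_ t) h - jacobi a b d h) @[t --> F] --> (0 : R).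
Proof.
move=> ha hb hd lh.
have supp t k : ~ nbhd_support h k ->
    (jacobi (a_ t) (b_ t) (d_ t) h - jacobi a b d h) k = 0.
  by move=> hk; rewrite !fctE !jacobi_support // subrr.
have fS := finite_nbhd_support lh.
have dl t := l2_finite_support fS (supp t).
under eq_fun do rewrite (l2norm_hdot (dl _).1) (dl _).2.
pose w_ k t := hterm ((jacobi (a_ t) (b_ t) (d_ t) h - jacobi a b d h) k)
  ((jacobi (a_ t) (b_ t) (d_ t) h - jacobi a b d h) k).
pose S t := \sum_(k <- fset_set (nbhd_support h)) w_ k t.
suff hS : S t @[t --> F] --> (0 : R).
  by have := continuous_cvg FF (@sqrt_continuous R 0) hS; rewrite sqrtr0.
suff w0 k : w_ k t @[t --> F] --> (0 : R).
  rewrite /S; move: (enum_fset _) => s; elim: s => [|k s IH].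
    by under eq_fun do rewrite big_nil; exact: cvg_cst.
  under eq_fun do rewrite big_cons.
  have := cvgD (w0 k) IH; rewrite addr0 => hh; exact: hh.
rewrite /w_.
under eq_fun do rewrite -normc_sqE.
have zc (u : T -> R) (m : R) : u t @[t --> F] --> (0 : R) ->
    u t * m @[t --> F] --> (0 : R).
  by move=> hu; have := cvgM hu (cvg_cst m); rewrite mul0r => hh; exact: hh.
have z : normc (a_ t k - a k) * normc (h (k + 1)) +
   (normc (b_ t k - b k) * normc (h k) +
    normc (d_ t k - d k) * normc (h (k - 1))) @[t --> F] --> (0 : R).
  have := cvgD (zc _ (normc (h (k + 1))) (ha k))
    (cvgD (zc _ (normc (h k)) (hb k)) (zc _ (normc (h (k - 1))) (hd k))).
  by rewrite !addr0 => hh; exact: hh.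
have w : normc ((jacobi (a_ t) (b_ t) (d_ t) h - jacobi a b d h) k) @[t --> F] --> (0 : R).
  apply: squeeze_cvgr (cvg_cst _) z; apply: nearW => t; rewrite normc_ge0 /=.
  have -> : (jacobi (a_ t) (b_ t) (d_ t) h - jacobi a b d h) k =
    (a_ t k - a k) * h (k + 1) + (- (b_ t k - b k) * h k + (d_ t k - d k) * h (k - 1)).
    by rewrite !fctE /jacobi; ring.
  apply: le_trans (le_normcD _ _) _; rewrite normcM lerD2l.
  by apply: le_trans (le_normcD _ _) _; rewrite !normcM normcN.
by under eq_fun do rewrite expr2; have := cvgM w w; rewrite mulr0 => hh; exact: hh.
Qed.

End OperatorClosure.

(** * Strong convergence of spectral projections *)

Section StrongConvergence.
Context {R : realType} (T : Type) (F : set_system T) (FF : Filter F).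
Variables (D : T -> (int -> R[i]) -> (int -> R[i])).
Variables (D0 : (int -> R[i]) -> (int -> R[i])).
Hypothesis D_lin : forall t c f g, D t (scl c f + g) = scl c (D t f) + D t g.
Hypothesis D_l2 : forall t h, l20 h -> l2 (D t h).
Hypothesis D0_lin : forall c f g, D0 (scl c f + g) = scl c (D0 f) + D0 g.
Hypothesis D0_l2 : forall h, l20 h -> l2 (D0 h).
Hypothesis D_cvg : forall h, l20 h ->
  l2norm (D t h - D0 h) @[t --> F] --> (0 : R).
Variables (E : T -> set R -> (int -> R[i]) -> (int -> R[i])).
Variables (E0 : set R -> (int -> R[i]) -> (int -> R[i])).
Hypothesis hE : forall t, spectral_measure (op_closure (D t)) (E t).
Hypothesis hE0 : spectral_measure (op_closure D0) E0.
Implicit Types (f g h : int -> R[i]) (I J : set R).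

(** One application of the induction hypothesis is made to [v = (A - c) g], which
    lies again in the range of [E0(I)] and has norm at most [r |g|]; dividing by
    [|c|], the expansion rate of [A_t - c] on the range of [E_t(J)], gains one
    factor [r / |c|]. *)
Lemma contraction_step I J c r n g e : measurable I -> measurable J ->
  0 <= r -> 0 < `|c| ->
  (forall x, I x -> `|x - c| <= r) -> (forall x, J x -> c * x <= 0) ->
  l2 g -> E0 I g = g -> 0 < e ->
  \forall t \near F, l2norm (E t J g) <= (r / `|c|) ^+ n * l2norm g + e.
Proof.
move=> mI mJ r0 c0 Ir Jc; elim: n g e => [|n IH] g e lg Eg e0.
  apply: nearW => t; rewrite expr0 mul1r.
  by apply: (le_trans (pvm_norm_le (hE t).1 mJ lg)); rewrite lerDl ltW.
(* The errors made with precision [d] below add up to [d (2 |c| + 3)], to be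
   compared with [|c| e]. *)
pose d := `|c| * e / (2 * `|c| + 3).
have cp : 0 < 2 * `|c| + 3 by lra.
have d0 : 0 < d by rewrite divr_gt0 // mulr_gt0.
have [g' hg [Eg' g'le]] := band_bound (@op_closure_l2 R D0)
  (op_closure_lin D0_lin D0_l2) hE0 mI lg Eg r0 Ir.
have [_ lg'] := op_closure_l2 hg.
have lcg : l2 (scl c%:C g) by l2_tac.
set v := g' - scl c%:C g in g'le.
have lv : l2 v by exact: l2B.
have Ev : E0 I v = v by rewrite /v (pvm_sub hE0.1) // (pvm_scl hE0.1) // Eg' Eg.
have [h [lh0 gh Dh]] := op_closure_approx hg d0.
have lh := l20_l2 lh0; have lD0 := D0_l2 lh0.
have Hv := IH v d lv Ev d0.
have HD := cvgr0_norm_lt (FF := FF) _ (D_cvg lh0) _ d0.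
apply: (filterS2 _ _ Hv HD) => t tv.
rewrite ger0_norm ?l2norm_ge0 // => tD; clear IH.
have pt := (hE t).1.
have lDt := D_l2 t lh0.
have lch : l2 (scl c%:C h) by l2_tac.
have lEg := pvm_l2 pt mJ lg; have lEh := pvm_l2 pt mJ lh.
have lgh : l2 (g - h) by l2_tac.
have s1 : l2norm (E t J g) <= d + l2norm (E t J h).
  have -> : E t J g = E t J (g - h) + E t J h by rewrite (pvm_sub pt) // subrK.
  apply: le_trans (l2normD _ _) _ => //; first exact: pvm_l2.
  rewrite lerD2r; apply: le_trans (pvm_norm_le pt mJ lgh) _; exact: ltW.
have s2 : `|c| * l2norm (E t J h) <= l2norm (E t J (D t h - scl c%:C h)).
  apply: (halfline_bound (@op_closure_l2 R (D t)) (op_closure_lin (D_lin t) (D_l2 t))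
    (hE t) mJ) => //.
  exact: (op_closure_l20 (D_l2 t) lh0).
pose w := (D t h - D0 h) - (g' - D0 h) + scl c%:C (g - h).
have ew : D t h - scl c%:C h = v + w.
  by apply/funext => k; rewrite /w /v !fctE /scl; ring.
have l1 : l2 (D t h - D0 h) by l2_tac.
have l3 : l2 (g' - D0 h) by l2_tac.
have l4 : l2 (scl c%:C (g - h)) by l2_tac.
have lw : l2 w by rewrite /w; l2_tac.
have nw : l2norm w <= d + d + `|c| * d.
  apply: le_trans (l2normD (l2B l1 l3) l4) _.
  apply: lerD; last by rewrite l2norm_scl // normc_real ler_wpM2l // ltW.
  apply: le_trans (l2normB l1 l3) _; apply: lerD; exact: ltW.
have s3 : l2norm (E t J (D t h - scl c%:C h)) <=
    (r / `|c|) ^+ n * l2norm v + d + (d + d + `|c| * d).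
  rewrite ew (pvm_add pt) //; apply: le_trans (l2normD _ _) _; [exact: pvm_l2..|].
  by apply: lerD => //; apply: le_trans (pvm_norm_le pt mJ lw) nw.
have q0 : 0 <= (r / `|c|) ^+ n by rewrite exprn_ge0 // divr_ge0.
have s4 : (r / `|c|) ^+ n * l2norm v <= (r / `|c|) ^+ n * (r * l2norm g).
  by rewrite ler_wpM2l.
have s5 : `|c| * ((r / `|c|) ^+ n.+1 * l2norm g) =
    (r / `|c|) ^+ n * (r * l2norm g).
  by rewrite exprS; field; rewrite gt_eqF.
have dE : d * (2 * `|c| + 3) = `|c| * e by rewrite /d divfK // gt_eqF.
rewrite -(ler_pM2l c0) mulrDr s5.
apply: (@le_trans _ _ (`|c| * (d + l2norm (E t J h)))); first by rewrite ler_pM2l.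
by rewrite mulrDr; lra.
Qed.

Lemma band_cvg I J c r g : measurable I -> measurable J ->
  0 <= r -> r < `|c| ->
  (forall x, I x -> `|x - c| <= r) -> (forall x, J x -> c * x <= 0) ->
  l2 g -> E0 I g = g -> l2norm (E t J g) @[t --> F] --> (0 : R).
Proof.
move=> mI mJ r0 rc Ir Jc lg Eg.
have c0 : 0 < `|c| by exact: le_lt_trans rc.
apply/cvgr0Pnorm_le => e e0.
have e2 : 0 < e / 2 by rewrite divr_gt0.
have q1 : `|r / `|c| | < 1.
  by rewrite ger0_norm ?divr_ge0 // ltr_pdivrMr // mul1r.
have [n hn] : exists n, (r / `|c|) ^+ n * l2norm g <= e / 2.
  have hh : (r / `|c|) ^+ n * l2norm g @[n --> \oo] --> (0 : R).
    rewrite -[X in _ --> X](mul0r (l2norm g)).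
    by apply: cvgM; [exact: cvg_expr|exact: cvg_cst].
  have [n _ hn] : \forall n \near \oo, `|(r / `|c|) ^+ n * l2norm g| <= e / 2.
    exact: cvgr0_norm_le hh _ e2.
  by exists n; have := hn n (leqnn n); exact: le_trans (ler_norm _).
have := contraction_step n mI mJ r0 c0 Ir Jc lg Eg e2; apply: filterS => t ht.
rewrite ger0_norm ?l2norm_ge0 //; lra.
Qed.

(** The sign [s] treats both half-lines at once. The open half-line [s x > 0] is
    exhausted by the bands [1 / (n + 1) <= s x <= n + 1], whose half-width is
    smaller than the distance from their centre to the origin. *)
Lemma halfline_cvg J s u : s ^+ 2 = 1 -> measurable J ->
  (forall x, J x -> s * x <= 0) -> l2 u -> E0 [set x | 0 < s * x] u = u ->
  l2norm (E t J u) @[t --> F] --> (0 : R).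
Proof.
move=> s1 mJ Js lu Eu.
pose I_ n : set R := [set x | n.+1%:R^-1 <= s * x <= n.+1%:R].
have mI n : measurable (I_ n).
  rewrite (_ : I_ n = setT `&` (fun x => s * x) @^-1` `[n.+1%:R^-1, n.+1%:R]%classic).
    have : measurable_fun setT (fun x : R => s * x) by exact: measurable_funM.
    by apply => //; exact: measurable_itv.
  by rewrite setTI; apply/seteqP; split => x; rewrite /I_ /= in_itv.
have IU : \bigcup_n I_ n = [set x | 0 < s * x].
  apply/seteqP; split => [x [n _ /andP[h _]]|x /= x0].
    by apply: lt_le_trans h; rewrite invr_gt0.
  have y0 : 0 < (s * x)^-1 by rewrite invr_gt0.
  exists (maxn (Num.truncn (s * x)) (Num.truncn (s * x)^-1)) => //.
  rewrite /I_ /=; apply/andP; split.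
    rewrite invf_ple ?posrE //.
    by apply: le_trans (ltW (truncnS_gt _)) _; rewrite ler_nat ltnS leq_maxr.
  by apply: le_trans (ltW (truncnS_gt _)) _; rewrite ler_nat ltnS leq_maxl.
have nd : nondecreasing_seq I_.
  move=> m n mn; apply/subsetPset => x /andP[h1 h2].
  apply/andP; split; last by apply: le_trans h2 _; rewrite ler_nat.
  by apply: le_trans h1; rewrite lef_pV2 ?posrE // ler_nat.
have cv := pvm_cvg hE0.1 mI nd lu; rewrite IU Eu in cv.
have lI n : l2 (E0 (I_ n) u) by exact: (pvm_l2 hE0.1).
have sq0 n : l2norm (u - E0 (I_ n) u) ^+ 2 =
    l2norm u ^+ 2 - l2norm (E0 (I_ n) u) ^+ 2.
  have lI' := lI n; rewrite !l2norm_sq //; last exact: l2B.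
  rewrite (hdotBl lu lI' (l2B lu lI')) (hdotBr lu lu lI') (hdotBr lI' lu lI').
  by rewrite (hdotC u (E0 _ _)) (pvm_sqr hE0.1) //; ring.
apply/cvgr0Pnorm_le => e e0.
have e2 : 0 < e / 2 by rewrite divr_gt0.
have [n hn] : exists n, l2norm (u - E0 (I_ n) u) <= e / 2.
  have hh : l2norm (u - E0 (I_ n) u) ^+ 2 @[n --> \oo] --> (0 : R).
    under eq_fun do rewrite sq0 (expr2 (l2norm (E0 _ _))).
    have h1 : l2norm u ^+ 2 - l2norm (E0 (I_ n) u) * l2norm (E0 (I_ n) u)
        @[n --> \oo] --> l2norm u ^+ 2 - l2norm u * l2norm u.
      by apply: cvgB; [exact: cvg_cst|exact: cvgM].
    by rewrite -expr2 subrr in h1.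
  have [n _ hn] : \forall n \near \oo,
      `|l2norm (u - E0 (I_ n) u) ^+ 2| <= (e / 2) ^+ 2.
    exact: cvgr0_norm_le hh _ (exprn_gt0 2 e2).
  exists n; have h := hn n (leqnn n).
  rewrite -(@ler_pXn2r _ 2) ?nnegrE ?l2norm_ge0 ?(ltW e2) //.
  by apply: le_trans h; exact: ler_norm.
have [p [q [pE qE p1 q0 q1]]] : exists p q : R,
    [/\ p = n.+1%:R, q = n.+1%:R^-1, 1 <= p, 0 < q & q <= 1].
  exists n.+1%:R, n.+1%:R^-1; split => //; first by rewrite ler1n.
  by rewrite invf_le1 // ler1n.
pose m := (q + p) / 2; pose r := (p - q) / 2.
have m0 : 0 < m by rewrite /m; lra.
have sN : `|s| = 1.
  by apply/eqP; rewrite -(@eqrXn2 _ 2) // real_normK ?num_real // s1 expr1n.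
have smN : `|s * m| = m by rewrite normrM sN mul1r gtr0_norm.
have cvI : l2norm (E t J (E0 (I_ n) u)) @[t --> F] --> (0 : R).
  apply: (@band_cvg (I_ n) J (s * m) r) => //.
  - by rewrite /r; lra.
  - by rewrite smN /r /m; lra.
  - move=> x /andP[h1 h2].
    have -> : x - s * m = s * (s * x - m) by rewrite mulrBr !mulrA -expr2 s1 mul1r.
    rewrite normrM sN mul1r ler_norml; rewrite -pE in h2; rewrite -qE in h1.
    by apply/andP; split; rewrite /r /m; lra.
  - by move=> x /Js h; rewrite mulrAC mulr_le0_ge0 // ltW.
  - exact: (pvm_idem hE0.1).
have := cvgr0_norm_le (FF := FF) _ cvI _ e2; apply: filterS => t.
rewrite !ger0_norm ?l2norm_ge0 // => ht.
have pt := (hE t).1; have lI' := lI n.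
have -> : E t J u = E t J (u - E0 (I_ n) u) + E t J (E0 (I_ n) u).
  by rewrite (pvm_sub pt) // subrK.
have ld : l2 (u - E0 (I_ n) u) by exact: l2B.
apply: le_trans (l2normD (pvm_l2 pt mJ ld) (pvm_l2 pt mJ lI')) _.
rewrite [e](_ : _ = e / 2 + e / 2); last by rewrite -splitr.
by apply: lerD => //; apply: le_trans (pvm_norm_le pt mJ ld) hn.
Qed.

Lemma spectral_projection_cvg f : (forall g, l2 g -> E0 [set 0] g = 0) -> l2 f ->
  l2norm (E t [set x | 0 < x] f - E0 [set x | 0 < x] f) @[t --> F] --> (0 : R).
Proof.
move=> ker lf; set pos := [set x : R | 0 < x].
have mpos : measurable pos.
  rewrite (_ : pos = `]0, +oo[%classic); first exact: measurable_itv.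
  by apply/seteqP; split => x; rewrite /= in_itv /= andbT.
have mneg : measurable [set x : R | 0 < -1 * x].
  rewrite (_ : mkset _ = `]-oo, 0[%classic); first exact: measurable_itv.
  by apply/seteqP; split => x; rewrite /= in_itv /= mulN1r oppr_gt0.
have mC := measurableC mpos.
pose u := E0 pos f; pose w := E0 (~` pos) f.
have lu : l2 u by exact: (pvm_l2 hE0.1).
have lw : l2 w by exact: (pvm_l2 hE0.1).
have cu : l2norm (E t (~` pos) u) @[t --> F] --> (0 : R).
  apply: (@halfline_cvg _ 1) => //; first by rewrite expr1n.
    by move=> x /negP; rewrite -leNgt mul1r.
  rewrite (_ : mkset _ = pos); first exact: (pvm_idem hE0.1).
  by apply/seteqP; split => x; rewrite /= mul1r.
have cw : l2norm (E t pos w) @[t --> F] --> (0 : R).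
  apply: (@halfline_cvg _ (-1)) => //; first by rewrite sqrrN expr1n.
    by move=> x /ltW x0; rewrite mulN1r oppr_le0.
  rewrite [RHS](pvm_split hE0.1 mneg lw).
  rewrite -[E0 (~` _) w](pvm_setI hE0.1 (measurableC mneg) mC lf).
  rewrite [X in E0 X f](_ : _ = [set 0]) ?ker ?addr0 //.
  apply/seteqP; split => x /=; last by move=> ->; rewrite /pos /= mulr0 ltxx; split.
  rewrite mulN1r oppr_gt0 => -[/negP + /negP]; rewrite -!leNgt => h1 h2.
  by apply/eqP; rewrite eq_le h1 h2.
have cc : l2norm (E t pos w) + l2norm (E t (~` pos) u) @[t --> F] --> (0 : R).
  by rewrite -[X in _ --> X](addr0 0); exact: cvgD.
apply: squeeze_cvgr (cvg_cst 0) cc; apply: nearW => t; rewrite l2norm_ge0 /=.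
have pt := (hE t).1.
have -> : E t pos f - E0 pos f = E t pos w - E t (~` pos) u.
  rewrite (pvm_setC pt mpos lu) {1}(pvm_split hE0.1 mpos lf) -/u -/w (pvm_add pt) //.
  by rewrite opprB addrA (addrC (E t pos w)).
by apply: l2normB; exact: (pvm_l2 pt).
Qed.

End StrongConvergence.

(** * The kernel of the Bessel operator *)

Section BesselKernel.
Context {R : realType}.
Implicit Types (g : int -> R[i]).

Lemma l2_pairs_cvg0 g : l2 g ->
  pairs (fun k => hterm (g k) (g k)) i @[i --> \oo] --> (0 : R).
Proof. by move=> /l2E /zsummable_cvg /cvg_series_cvg_0. Qed.

Lemma normcM_le (x y : R[i]) : normc (x * conjc y) <= hterm x x + hterm y y.
Proof.
rewrite normcM -!normc_sqE.
have -> : normc (conjc y) = normc y by case: y => b c; rewrite /= sqrrN.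
have := sqr_ge0 (normc x - normc y); have := sqr_ge0 (normc x).
have := sqr_ge0 (normc y); nra.
Qed.

(** [S i] is, up to sign, the Wronskian at [i] of [g] and of the conjugate of the
    function [k |-> (-1)^k g(- 1 - k)], which solves the same recurrence. Its
    modulus is therefore constant, equal to [|g(0)|^2 + |g(-1)|^2]; it tends to 0
    as [g] is square-summable. Then [g(0) = g(-1) = 0], and the recurrence
    propagates this in both directions. *)
Lemma bessel_kernel (a : R) g : a != 0 -> l2 g ->
  (forall k, a%:C * g (k + 1) - (Defs.half R k)%:C * g k + a%:C * g (k - 1) = 0) ->
  g = 0.
Proof.
move=> a0 lg rec.
have ac : a%:C != 0 :> R[i] by rewrite -(rmorph0 (real_complex R)) (inj_eq (@complexI R)).
have h1 (i : nat) : a%:C * g (Posz i.+2) = (Defs.half R (Posz i.+1))%:C * g (Posz i.+1) - a%:C * g (Posz i).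
  have := rec (Posz i.+1).
  have -> : Posz i.+1 + 1 = Posz i.+2 by lia.
  have -> : Posz i.+1 - 1 = Posz i by lia.
  by move/eqP; rewrite addr_eq0 subr_eq => /eqP ->; rewrite addrC.
have h2 (i : nat) : a%:C * g (Negz i.+2) = - (Defs.half R (Posz i.+1))%:C * g (Negz i.+1) - a%:C * g (Negz i).
  have := rec (Negz i.+1).
  have -> : Negz i.+1 + 1 = Negz i by lia.
  have -> : Negz i.+1 - 1 = Negz i.+2 by lia.
  have -> : Defs.half R (Negz i.+1) = - Defs.half R (Posz i.+1).
    have -> : Negz i.+1 = - (Posz i.+1) - 1 by lia.
    by rewrite /Defs.half rmorphB rmorphN /=; field.
  move/eqP; rewrite addrC addr_eq0 => /eqP ->.
  by rewrite rmorphN opprB.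
have h3 : a%:C * g 1 = (Defs.half R 0)%:C * g 0 - a%:C * g (Negz 0).
  have := rec 0; have -> : 0 - 1 = Negz 0 by lia.
  by rewrite add0r => /eqP; rewrite addr_eq0 subr_eq => /eqP ->; rewrite addrC.
have h4 : a%:C * g (Negz 1) = - (Defs.half R 0)%:C * g (Negz 0) - a%:C * g 0.
  have := rec (Negz 0).
  have -> : Negz 0 + 1 = 0 by lia.
  have -> : Negz 0 - 1 = Negz 1 by lia.
  have -> : Defs.half R (Negz 0) = - Defs.half R 0.
    have -> : Negz 0 = - 1 by lia.
    by rewrite /Defs.half rmorphN rmorph1 rmorph0 /=; field.
  move/eqP; rewrite addrC addr_eq0 => /eqP ->.
  by rewrite rmorphN opprB.
pose S (i : nat) := g (Posz i.+1) * conjc (g (Negz i)) +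
  g (Posz i) * conjc (g (Negz i.+1)).
have cj (b : R) (x y w : R[i]) : a%:C * x = - b%:C * y - a%:C * w ->
    a%:C * conjc x = - b%:C * conjc y - a%:C * conjc w.
  move=> /(congr1 conjc) h.
  have cZ (r : R) v : conjc (r%:C * v) = r%:C * conjc v.
    by case: v => p q; simpc.
  have cN (v : R[i]) : conjc (- v) = - conjc v by case: v.
  have cD (v v' : R[i]) : conjc (v + v') = conjc v + conjc v'.
    exact: rmorphD.
  by move: h; rewrite mulNr cD !cN !cZ => ->; rewrite mulNr.
have SS i : S i.+1 = - S i.
  apply: (mulfI ac); rewrite /S mulrDr mulrA h1.
  rewrite [X in _ + X]mulrCA (cj _ _ _ _ (h2 i)); ring.
have S0 : S 0 = - (hterm (g 0) (g 0) + hterm (g (Negz 0)) (g (Negz 0)))%:C.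
  have sq (x : R[i]) : (hterm x x)%:C = x * conjc x.
    case: x => b c; apply/eqP; rewrite eq_complex /hterm /=.
    by apply/andP; split; apply/eqP; ring.
  have -> : (hterm (g 0) (g 0) + hterm (g (Negz 0)) (g (Negz 0)))%:C =
      g 0 * conjc (g 0) + g (Negz 0) * conjc (g (Negz 0)).
    by rewrite -!sq -rmorphD.
  apply: (mulfI ac); rewrite /S mulrDr mulrA h3.
  rewrite [X in _ + X]mulrCA (cj _ _ _ _ h4); ring.
pose s := hterm (g 0) (g 0) + hterm (g (Negz 0)) (g (Negz 0)).
have s0 : 0 <= s by rewrite addr_ge0 // hterm_ge0.
have nS i : normc (S i) = s.
  elim: i => [|i IH]; last by rewrite SS normcN.
  by rewrite S0 normcN normc_real ger0_norm.
pose p := pairs (fun k => hterm (g k) (g k)).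
have sp i : s <= p i + p i.+1.
  rewrite -(nS i) /S; apply: le_trans (le_normcD _ _) _.
  apply: le_trans (lerD (normcM_le _ _) (normcM_le _ _)) _.
  by rewrite /p /pairs; lra.
have s00 : s = 0.
  apply/eqP; rewrite eq_le s0 andbT; apply/ler_addgt0Pl => e e0.
  rewrite addr0; have e2 : 0 < e / 2 by rewrite divr_gt0.
  have [n _ hn] : \forall n \near \oo, `|p n| <= e / 2.
    exact: cvgr0_norm_le (l2_pairs_cvg0 lg) _ e2.
  have b1 := le_trans (ler_norm _) (hn n (leqnn n)).
  have b2 := le_trans (ler_norm _) (hn n.+1 (leqnSn n)).
  apply: le_trans (sp n) _; rewrite [e](_ : _ = e / 2 + e / 2); last exact: splitr.
  exact: lerD.
have [g0 gN] : g 0 = 0 /\ g (Negz 0) = 0.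
  move/eqP: s00; rewrite paddr_eq0 ?hterm_ge0 // -!normc_sqE !sqrf_eq0.
  by move=> /andP[/eqP /eq0_normc -> /eqP /eq0_normc ->].
have gP (i : nat) : g (Posz i) = 0 /\ g (Posz i.+1) = 0.
  elim: i => [|i [IH1 IH2]]; split => //; apply: (mulfI ac); rewrite mulr0.
    by rewrite h3 g0 gN !mulr0 subrr.
  by rewrite h1 IH1 IH2 !mulr0 subrr.
have gM (i : nat) : g (Negz i) = 0 /\ g (Negz i.+1) = 0.
  elim: i => [|i [IH1 IH2]]; split => //; apply: (mulfI ac); rewrite mulr0.
    by rewrite h4 g0 gN !mulr0 subrr.
  by rewrite h2 IH1 IH2 !mulr0 subrr.
by apply/funext => -[i|i]; [exact: (gP i).1|exact: (gM i).1].
Qed.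

(** The set [{0}] is the band of centre 0 and half-width 0, so the operator
    vanishes on the range of [E({0})]. *)
Lemma bessel_spectral_kernel (theta : R) E : 0 < theta ->
  spectral_measure (op_closure (bessel_op theta)) E ->
  forall g, l2 g -> E [set 0] g = 0.
Proof.
move=> th hE g lg; have m0 : measurable [set (0 : R)] by exact: measurable_set1.
pose D := jacobi (fun=> (Num.sqrt theta)%:C) (fun k => (Defs.half R k)%:C)
  (fun=> (Num.sqrt theta)%:C).
have hE' : spectral_measure (op_closure D) E := hE.
have lu := pvm_l2 hE.1 m0 lg; have Eu := pvm_idem hE.1 m0 lg.
set u := E [set 0] g in lu Eu *.
have [u' hu [_]] := @band_bound _ _ _ (@op_closure_l2 R D)
  (op_closure_lin (jacobi_lin _ _ _) (jacobi_l2 _ _ _)) hE' _ u 0 0 m0 lu Eu (lexx _)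
  (fun x (e : x = 0) => ltac:(by rewrite e subrr normr0)).
have -> : scl (0 : R)%:C u = 0 by apply/funext => k; rewrite /scl mul0r.
rewrite subr0 mul0r => u'0.
have lu' := (op_closure_l2 hu).2.
have {}u'0 : u' = 0.
  by apply: l2norm_eq0 => //; apply/eqP; rewrite eq_le u'0 l2norm_ge0.
apply: (@bessel_kernel (Num.sqrt theta)) => //.
  by rewrite sqrtr_eq0 -ltNge.
move=> k; have := op_closure_jacobi hu; rewrite u'0 => /(congr1 (fun f => f k)).
by rewrite /jacobi => <-.
Qed.

End BesselKernel.

(** * The coefficients of the hypergeometric operator *)

Section Coefficients.
Context {R : realType}.
Implicit Types (z : R[i]) (xi theta : R).

(** The points [x - 1/2] and [x + 1/2], for [x] a half-integer, are integers;
    hence the radicands only involve integer shifts of [z] and [z']. *)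
Lemma half_sub k : (Defs.half R k)%:C - 2^-1 = k%:~R :> R[i].
Proof.
have -> : (2^-1 : R[i]) = (2^-1)%:C by rewrite fmorphV rmorph_nat.
by rewrite -rmorphB /Defs.half addrK rmorph_int.
Qed.

Lemma half_add k : (Defs.half R k)%:C + 2^-1 = (k + 1)%:~R :> R[i].
Proof.
rewrite -[(Defs.half R k)%:C](subrK 2^-1) half_sub -addrA -mulr2n.
by rewrite -[2^-1 *+ 2]mulr_natr mulVf ?pnatr_eq0 // rmorphD.
Qed.

Definition radicand z z' xi (j : int) : R[i] :=
  xi%:C * (z + j%:~R) * (z' + j%:~R).

(** In the principal series the two shifted parameters are conjugate; in the
    complementary series they lie in the same interval between consecutive
    integers, hence have the same sign. *)
Lemma radicand_ge0 z z' xi j :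
  principal_series z z' xi \/ complementary_series z z' xi ->
  0 <= radicand z z' xi j.
Proof.
rewrite /radicand -mulrA; case=> [[-> _ /andP[x0 _]]|].
  rewrite mulr_ge0 //; first by rewrite ler0c ltW.
  have -> : conjc z + j%:~R = conjc (z + j%:~R).
    by rewrite rmorphD rmorph_int.
  exact: mulcJ_ge0.
case: z z' => a b [a' b'] [/= -> -> [m [/andP[h1 h2] /andP[h3 h4]]] /andP[x0 _]].
have -> : j%:~R = (j%:~R)%:C :> R[i] by rewrite rmorph_int.
rewrite -[a +i* 0]/(a%:C) -[a' +i* 0]/(a'%:C) -!rmorphD -!rmorphM ler0c.
rewrite mulr_ge0 ?(ltW x0) //.
have [n0|n0] := leP 0 (m + j).
  have n0' : 0 <= (m + j)%:~R :> R by rewrite ler0z.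
  by rewrite rmorphD /= in n0'; apply: mulr_ge0; lra.
have n0' : (m + 1 + j)%:~R <= 0 :> R by rewrite lerz0; lia.
rewrite rmorphD /= in n0'; apply: mulr_le0; lra.
Qed.

(** [r - s = (r^2 - s^2) / (r + s)], with [r + s >= s] for the nonnegative root
    [r] of [w] and [s] the root of [theta]. *)
Lemma sqrtC_dist (w : R[i]) theta : 0 < theta -> 0 <= w ->
  normc (sqrtC w - (Num.sqrt theta)%:C) <=
  normc (w - theta%:C) / Num.sqrt theta.
Proof.
move=> th w0; have s0 : 0 <= sqrtC w by rewrite sqrtC_ge0.
have := sqrtCK w; move: s0; set s := sqrtC w => s0 sE.
have [r [r0 rE]] : exists r : R, 0 <= r /\ s = r%:C.
  move: s0; rewrite lecE /=; case: s {sE} => a b /= /andP[/eqP -> a0].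
  by exists a.
have q0 : 0 < Num.sqrt theta by rewrite sqrtr_gt0.
rewrite -sE rE -rmorphXn -!rmorphB !normc_real ler_pdivlMr //.
have -> : r ^+ 2 - theta = (r - Num.sqrt theta) * (r + Num.sqrt theta).
  by rewrite -{1}(sqr_sqrtr (ltW th)) -subr_sqr.
rewrite normrM ler_wpM2l // ger0_norm; lra.
Qed.

Lemma cvg0_of_bounded_mul (T : Type) (F : set_system T) (FF : Filter F)
    (u v : T -> R) (K : R) : (forall t, 0 <= u t) ->
  (\forall t \near F, u t * v t <= K) -> v t @[t --> F] --> +oo ->
  u t @[t --> F] --> (0 : R).
Proof.
move=> u0 uv /cvgryPge vy; apply/cvgr0Pnorm_le => e e0.
have := vy ((`|K| + 1) / e); apply: filterS2 uv => t h1 h2.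
rewrite ger0_norm // leNgt; apply/negP => eu.
have p0 : 0 < (`|K| + 1) / e by rewrite divr_gt0 // ltr_wpDl.
have : e * ((`|K| + 1) / e) <= u t * v t.
  by apply: ler_pM => //; exact: ltW.
rewrite mulrC divfK ?gt_eqF //; have := ler_norm K; lra.
Qed.

Section Limit.
Variables (theta : R) (htheta : 0 < theta).
Variables (T : Type) (F : set_system T) (FF : Filter F).
Variables (z z' : T -> R[i]) (xi : T -> R).
Hypothesis hseries : forall t, principal_series (z t) (z' t) (xi t) \/
                         complementary_series (z t) (z' t) (xi t).
Hypothesis hxi : xi t @[t --> F] --> (0 : R).
Hypothesis hz : normc (z t) @[t --> F] --> +oo.
Hypothesis hz' : normc (z' t) @[t --> F] --> +oo.
Hypothesis hlim : normc ((xi t)%:C * z t * z' t - theta%:C)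
              @[t --> F] --> (0 : R).

Lemma series_xi_gt0 t : 0 < xi t.
Proof. by case: (hseries t) => [[_ _ /andP[]]|[_ _ _ /andP[]]]. Qed.

Lemma xi_zz_bounded : \forall t \near F,
  xi t * (normc (z t) * normc (z' t)) <= theta + 1.
Proof.
have := cvgr0_norm_le (FF := FF) _ hlim _ (@ltr01 R); apply: filterS => t.
rewrite ger0_norm ?normc_ge0 // => h.
have <- : normc ((xi t)%:C * z t * z' t) = xi t * (normc (z t) * normc (z' t)).
  by rewrite !normcM normc_real gtr0_norm ?series_xi_gt0 // mulrA.
rewrite -[X in normc X](subrK theta%:C); apply: le_trans (le_normcD _ _) _.
by rewrite normc_real gtr0_norm //; lra.
Qed.

(** [xi |z|] is a bounded quantity divided by [|z'|]. *)
Lemma xi_z_cvg0 : xi t * normc (z t) @[t --> F] --> (0 : R).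
Proof.
apply: (@cvg0_of_bounded_mul _ _ FF _ _ (theta + 1) _ _ hz').
  by move=> t; rewrite mulr_ge0 ?normc_ge0 // ltW // series_xi_gt0.
by have := xi_zz_bounded; apply: filterS => t; rewrite mulrA.
Qed.

Lemma xi_z'_cvg0 : xi t * normc (z' t) @[t --> F] --> (0 : R).
Proof.
apply: (@cvg0_of_bounded_mul _ _ FF _ _ (theta + 1) _ _ hz).
  by move=> t; rewrite mulr_ge0 ?normc_ge0 // ltW // series_xi_gt0.
by have := xi_zz_bounded; apply: filterS => t; rewrite -mulrA [normc _ * _]mulrC.
Qed.

Lemma cvg0_mulr (u : T -> R) (m : R) : u t @[t --> F] --> (0 : R) ->
  u t * m @[t --> F] --> (0 : R).
Proof.
by move=> hu; have := cvgM hu (cvg_cst m); rewrite mul0r => hh; exact: hh.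
Qed.

Lemma cvg0_add (u v : T -> R) : u t @[t --> F] --> (0 : R) ->
  v t @[t --> F] --> (0 : R) -> u t + v t @[t --> F] --> (0 : R).
Proof.
by move=> hu hv; have := cvgD hu hv; rewrite addr0 => hh; exact: hh.
Qed.

Lemma cvg0_le (u v : T -> R) : (forall t, 0 <= u t <= v t) ->
  v t @[t --> F] --> (0 : R) -> u t @[t --> F] --> (0 : R).
Proof. by move=> uv; apply: squeeze_cvgr (cvg_cst 0); exact: nearW. Qed.

Lemma normc_xi t (x : R[i]) : normc ((xi t)%:C * x) = xi t * normc x.
Proof. by rewrite normcM normc_real gtr0_norm ?series_xi_gt0. Qed.

(** Expanding the product leaves, besides [xi z z'], terms controlled by
    [xi |z|], [xi |z'|] and [xi]. *)
Lemma radicand_cvg j :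
  normc (radicand (z t) (z' t) (xi t) j - theta%:C) @[t --> F] --> (0 : R).
Proof.
pose N := normc (j%:~R : R[i]).
apply: (@cvg0_le _ (fun t => normc ((xi t)%:C * z t * z' t - theta%:C) +
  (xi t * normc (z t) * N + (xi t * normc (z' t) * N + xi t * N ^+ 2)))).
  move=> t; rewrite normc_ge0 /=.
  have -> : radicand (z t) (z' t) (xi t) j - theta%:C =
    ((xi t)%:C * z t * z' t - theta%:C) + ((xi t)%:C * (z t * j%:~R) +
      ((xi t)%:C * (z' t * j%:~R) + (xi t)%:C * (j%:~R * j%:~R))).
    by rewrite /radicand; ring.
  apply: le_trans (le_normcD _ _) _; rewrite lerD2l.
  have e (x : R[i]) : normc ((xi t)%:C * (x * j%:~R)) = xi t * normc x * N.
    by rewrite normc_xi normcM mulrA.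
  apply: le_trans (le_normcD _ _) _; rewrite e lerD2l.
  by apply: le_trans (le_normcD _ _) _; rewrite !e expr2 mulrA.
apply: cvg0_add => //; apply: cvg0_add; first exact: cvg0_mulr xi_z_cvg0.
apply: cvg0_add; first exact: cvg0_mulr xi_z'_cvg0.
exact: cvg0_mulr.
Qed.

Lemma offdiag_cvg j :
  normc (sqrtC (radicand (z t) (z' t) (xi t) j) - (Num.sqrt theta)%:C)
    @[t --> F] --> (0 : R).
Proof.
apply: (cvg0_le _ (cvg0_mulr (Num.sqrt theta)^-1 (radicand_cvg j))) => t.
by rewrite normc_ge0 /= sqrtC_dist // radicand_ge0.
Qed.

Lemma diag_cvg (x : R[i]) :
  normc (x + (xi t)%:C * (z t + z' t + x) - x) @[t --> F] --> (0 : R).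
Proof.
apply: (@cvg0_le _ (fun t => xi t * normc (z t) + (xi t * normc (z' t) +
  xi t * normc x))).
  move=> t; rewrite normc_ge0 /= addrAC subrr add0r normc_xi -!mulrDr.
  rewrite ler_wpM2l ?(ltW (series_xi_gt0 t)) // -addrA.
  apply: le_trans (le_normcD _ _) _; rewrite lerD2l; exact: le_normcD.
apply: cvg0_add; first exact: xi_z_cvg0.
apply: cvg0_add; first exact: xi_z'_cvg0.
exact: cvg0_mulr.
Qed.

End Limit.
End Coefficients.

Lemma diff_op_jacobi (R : realType) (z z' : R[i]) (xi : R) :
  diff_op z z' xi =
  jacobi (fun k => sqrtC (radicand z z' xi (k + 1)))
    (fun k => (Defs.half R k)%:C + xi%:C * (z + z' + (Defs.half R k)%:C))
    (fun k => sqrtC (radicand z z' xi k)).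
Proof.
apply/funext => f; apply/funext => k; rewrite /diff_op /jacobi /radicand.
by rewrite -!addrA !half_add !half_sub !addrA.
Qed.

Unset Implicit Arguments.

Theorem corollary4p4 (R : realType) (theta : R) (htheta : 0 < theta)
    (T : Type) (F : set_system T) (FF : Filter F)
    (z z' : T -> R[i]) (xi : T -> R)
    (hseries : forall t, principal_series (z t) (z' t) (xi t) \/
                         complementary_series (z t) (z' t) (xi t))
    (hxi : xi t @[t --> F] --> (0 : R))
    (hz : ComplexField.Normc.normc (z t) @[t --> F] --> +oo)
    (hz' : ComplexField.Normc.normc (z' t) @[t --> F] --> +oo)
    (hlim : ComplexField.Normc.normc ((xi t)%:C * z t * z' t - theta%:C)
              @[t --> F] --> (0 : R))
    (P : T -> (int -> R[i]) -> (int -> R[i]))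
    (hP : forall t,
       Proj_plus (op_closure (diff_op (z t) (z' t) (xi t))) (P t))
    (P0 : (int -> R[i]) -> (int -> R[i]))
    (hP0 : Proj_plus (op_closure (bessel_op theta)) P0) :
  forall f, l2 f -> l2norm (P t f \- P0 f) @[t --> F] --> (0 : R).
Proof.
move=> f lf; have [E0 hE0 P0E] := hP0.
have /choice [E hE] : forall t, exists E,
    spectral_measure (op_closure (diff_op (z t) (z' t) (xi t))) E /\
    forall f, l2 f -> P t f = E [set x | 0 < x] f.
  by move=> t; have [E hE PE] := hP t; exists E.
have -> : (fun t => l2norm (P t f \- P0 f)) =
    (fun t => l2norm (E t [set x | 0 < x] f - E0 [set x | 0 < x] f)).
  by apply/funext => t; rewrite (hE t).2 // P0E.
apply: (@spectral_projection_cvg R T F FF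
  (fun t => diff_op (z t) (z' t) (xi t)) (bessel_op theta)) => //.
- by move=> t c g h; rewrite diff_op_jacobi jacobi_lin.
- by move=> t h lh; rewrite diff_op_jacobi; exact: jacobi_l2.
- exact: jacobi_lin.
- exact: jacobi_l2.
- move=> h lh; under eq_fun do rewrite diff_op_jacobi.
  apply: (jacobi_cvg FF) lh => k.
  + exact: (offdiag_cvg htheta FF hseries).
  + exact: (diag_cvg htheta FF hseries).
  + exact: (offdiag_cvg htheta FF hseries).
- by move=> t; exact: (hE t).1.
- exact: bessel_spectral_kernel hE0.
Qed.
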